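(* Let $\underline{\lambda}=(\lambda_1^{\rho_1}>\lambda_2^{\rho_2}>\cdots>\lambda_k^{\rho_k})$ be a partition and set $\lambda_{k+1}=0$. Let $p\neq 3$ be an odd prime, let $\mathcal{A}_{\underline{\lambda}}=\bigoplus_{i=1}^k(\mathbb{Z}/p^{\lambda_i}\mathbb{Z})^{\rho_i}$ and let $\mathcal{G}_{\underline{\lambda}}=\operatorname{Aut}(\mathcal{A}_{\underline{\lambda}})$. Then, for the trivial action of $\mathcal{G}_{\underline{\lambda}}$ on $\mathcal{A}_{\underline{\lambda}}$, $H^2(\mathcal{G}_{\underline{\lambda}},\mathcal{A}_{\underline{\lambda}})=0$ if and only if $\lambda_i-\lambda_{i+1}\leq 1$ for all $1\leq i\leq k$.
   Context: A partition $\underline{\lambda}=(\lambda_1^{\rho_1}>\cdots>\lambda_k^{\rho_k})$ consists of positive integers $\lambda_1>\lambda_2>\cdots>\lambda_k$ (the distinct parts) with positive integer multiplicities $\rho_1,\dots,\rho_k$, $k\geq 1$. $H^i$ denotes ordinary group cohomology. *)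

(* Defs.v *)
From HB Require Import structures.
From mathcomp Require Import all_boot all_algebra all_fingroup.

Set Implicit Arguments.
Unset Strict Implicit.
Unset Printing Implicit Defensive.

Import GRing.Theory FinRing.Theory.

Local Open Scope ring_scope.

Record gmodule (gT : finGroupType) (M : finZmodType) := GModule {
  gact :> gT -> {additive M -> M};
  gact1 : forall m, gact 1%g m = m;
  gactM : forall g h m, gact (g * h)%g m = gact g (gact h m)
}.

Definition trivial_gmodule (gT : finGroupType) (M : finZmodType) :
    gmodule gT M :=
  @GModule gT M (fun=> idfun) (fun=> erefl) (fun _ _ _ => erefl).

Section GroupCohomology.

Variables (gT : finGroupType) (M : finZmodType) (act : gmodule gT M).

(* Inhomogeneous n-cochains, i.e. all functions gT^n -> M. *)
Definition cochain n : Type := {ffun {ffun 'I_n -> gT} -> M}.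

HB.instance Definition _ n := Finite.on (cochain n).
HB.instance Definition _ n := GRing.Zmodule.on (cochain n).
(* The additive group; stated because [cochain n] would otherwise unfold and
   pick up the group structure of {ffun _ -> _}. *)
HB.instance Definition _ n := [finGroupMixin of cochain n for +%R].

Definition face_first n (g : {ffun 'I_n.+1 -> gT}) : {ffun 'I_n -> gT} :=
  [ffun j : 'I_n => g (lift ord0 j)].

Definition face_last n (g : {ffun 'I_n.+1 -> gT}) : {ffun 'I_n -> gT} :=
  [ffun j : 'I_n => g (widen_ord (leqnSn n) j)].

(* (g_0, ..., g_n) |-> (g_0, ..., g_i * g_(i+1), ..., g_n) *)
Definition face_mul n (i : 'I_n) (g : {ffun 'I_n.+1 -> gT}) :
    {ffun 'I_n -> gT} :=
  [ffun j : 'I_n =>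
     if (j < i)%N then g (widen_ord (leqnSn n) j)
     else if j == i then (g (widen_ord (leqnSn n) j) * g (lift ord0 j))%g
     else g (lift ord0 j)].

(* (d f)(g_0, ..., g_n) = g_0 . f(g_1, ..., g_n)
     + \sum_(0 <= i < n) (-1)^(i+1) f(g_0, ..., g_i g_(i+1), ..., g_n)
     + (-1)^(n+1) f(g_0, ..., g_(n-1)) *)
Definition coboundary n (f : cochain n) : cochain n.+1 :=
  [ffun g : {ffun 'I_n.+1 -> gT} =>
     act (g ord0) (f (face_first g))
     + \sum_(i < n) f (face_mul i g) *~ (-1) ^+ i.+1
     + f (face_last g) *~ (-1) ^+ n.+1].

Lemma coboundaryD n :
  {in [set: cochain n] &, {morph @coboundary n : f h / (f * h)%g}}.
Proof.
move=> f h _ _; change (coboundary (f + h) = coboundary f + coboundary h).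
apply/ffunP => g; rewrite !ffunE raddfD mulrzDl.
under eq_bigr => i _ do rewrite ffunE mulrzDl.
by rewrite big_split /= [RHS]addrACA; congr (_ + _); rewrite [RHS]addrACA.
Qed.

Canonical coboundary_morphism n := Morphism (@coboundaryD n).

Definition cocycles n : {group cochain n} :=
  'ker (coboundary_morphism n).

Definition coboundaries n : {group cochain n} :=
  match n with
  | 0 => 1%G
  | m.+1 => (coboundary_morphism m @* [set: cochain m])%G
  end.

(* H^n(gT, M) = Z^n / B^n; being a quotient in the sense of finite group
   theory it is written multiplicatively, with trivial group 1. *)
Definition cohomology n : {group coset_of (coboundaries n)} :=
  (cocycles n / coboundaries n)%G.

End GroupCohomology.

(* The direct sum over i < k of (Z / p^(lambda_i))^(rho_i). When p is prime,
   'Z_(p ^ l) is Z/p^l only for l > 0: for l = 0 it would be Z/2. *)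
Section AbelianPGroup.

Variables (p k : nat) (lambda rho : k.-tuple nat).

Definition abelian_pgroup : Type :=
  {dffun forall i : 'I_k, 'rV['Z_(p ^ tnth lambda i)]_(tnth rho i)}.

HB.instance Definition _ := Finite.on abelian_pgroup.

Implicit Types x y : abelian_pgroup.

Definition abp_zero : abelian_pgroup := [ffun i => 0].
Definition abp_opp x : abelian_pgroup := [ffun i => - x i].
Definition abp_add x y : abelian_pgroup := [ffun i => x i + y i].

Fact abp_addA : associative abp_add.
Proof. by move=> x y z; apply/ffunP => i; rewrite !ffunE addrA. Qed.
Fact abp_addC : commutative abp_add.
Proof. by move=> x y; apply/ffunP => i; rewrite !ffunE addrC. Qed.
Fact abp_add0 : left_id abp_zero abp_add.
Proof. by move=> x; apply/ffunP => i; rewrite !ffunE add0r. Qed.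
Fact abp_addN : left_inverse abp_zero abp_opp abp_add.
Proof. by move=> x; apply/ffunP => i; rewrite !ffunE addNr. Qed.

HB.instance Definition _ :=
  GRing.isZmodule.Build abelian_pgroup abp_addA abp_addC abp_add0 abp_addN.
HB.instance Definition _ := [finGroupMixin of abelian_pgroup for +%R].

(* Permutations are multiplied in diagrammatic order, so this is the opposite
   of the automorphism group under composition; the two are isomorphic by
   inversion, which is compatible with the trivial actions. *)
Definition aut_abelian_pgroup : finGroupType :=
  [subg Aut [set: abelian_pgroup]].

End AbelianPGroup.

(* Main.v *)
(* A central extension of a finite group G by a p-group splits as soon as it
   does over some subgroup of index prime to p (Gaschutz), and if N <| G and
   both N and G / N have no p-quotient and only split central extensions by
   p-groups, then so does G. Call such groups p-superperfect.

   Let A have a basis e_0, ..., e_(n-1) of orders p ^ l_i, with l_i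
   nonincreasing and l_n = 0. The stabilizer M of the flag
   F_i = <e_a : a >= i> + pA has index prime to p in Aut A, since its unipotent
   radical is a Sylow subgroup. Put Z_i = F_i :&: A[p ^ l_i] and
   K_i = {g in M : (g - 1) A <= Z_i}, so that M = K_0 >= ... >= K_n = 1. When all
   l_i - l_(i+1) are at most 1, one has p Z_i <= Z_(i+1) and K_i / K_(i+1) has a
   subgroup of index prime to p generated by two elementary abelian groups B and
   C of commuting transvections with [B, C] central and isomorphic to B (x) C,
   on which doubling e_i acts by squaring on B and by square roots on C. In a
   central extension by a p-group, p > 3, these actions select lifts of B and C
   satisfying the same relations, and counting shows that the group they generate
   meets the kernel trivially. Hence K_i / K_(i+1), then M, then Aut A, is
   p-superperfect, and every 2-cocycle is a coboundary.

   If l_i - l_(i+1) >= 2, then Aut A acts on a free Z / p ^ 2-module of rank i + 1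
   and the Fermat quotient of the determinant is a nonzero character of Aut A
   mod p. If every 2-cocycle were a coboundary, then this character would lift
   modulo p ^ r for every r, which is absurd for a finite group. *)

Require Import Defs.
From HB Require Import structures.
From mathcomp Require Import all_boot all_algebra all_fingroup all_solvable ring.

Set Implicit Arguments.
Unset Strict Implicit.
Unset Printing Implicit Defensive.

Import GroupScope.

(** * Central extensions by p-groups *)

Section Superperfect.

Variable p : nat.

Definition p_perfect (gT : finGroupType) (G : {group gT}) : Prop :=
  forall K : {group gT}, K <| G -> p.-nat #|G : K| -> G \subset K.

(** Equivalent to H^2(G, C) = 0 for every finite abelian p-group C with trivial action. *)
Definition central_p_split (gT : finGroupType) (G : {group gT}) : Prop :=
  forall (hT : finGroupType) (E : {group hT}) (f : {morphism E >-> gT}),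
    f @* E = G -> 'ker f \subset 'Z(E) -> p.-group ('ker f) ->
    [splits E, over 'ker f].

(** Homologically, H_1(G, Z) and H_2(G, Z) have order prime to p. The first half makes complements
    of a central p-kernel unique, which [p_superperfect_ext] needs to glue splittings. *)
Definition p_superperfect (gT : finGroupType) (G : {group gT}) : Prop :=
  p_perfect G /\ central_p_split G.

Lemma superperfect1 (gT : finGroupType) : p_superperfect [1 gT]%G.
Proof.
split=> [K _ _ | hT E f fE _ _]; first exact: sub1G.
have -> : 'ker f = E.
  by apply/eqP; rewrite eqEsubset subsetIl; apply/subsetP => x Ex;
     apply/kerP=> //; apply/set1P; rewrite -[[set 1]]/([1 gT]%G : {set gT}) -fE mem_morphim.
apply/splitsP; exists 1%G; apply/complP; split; first exact: setIg1.
exact: mulg1.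
Qed.

(** The kernel is an abelian p-group and the preimage of M has index |G : M|, prime to p, so
    Gaschutz's theorem applies. *)
Lemma splits_preim (gT hT : finGroupType) (G M : {group gT}) (E : {group hT})
    (f : {morphism E >-> gT}) :
  f @* E = G -> 'ker f \subset 'Z(E) -> p.-group ('ker f) ->
  M \subset G -> p^'.-nat #|G : M| ->
  [splits f @*^-1 M, over 'ker f] -> [splits E, over 'ker f].
Proof.
move=> fE sCZ pC sMG p'GM sM.
have preE : f @*^-1 G = E by rewrite -fE morphimGK ?subsetIl.
have abC : abelian ('ker f) by apply: abelianS sCZ _; apply: center_abelian.
rewrite (@Gaschutz_split _ E ('ker f)%G (f @*^-1 M)%G) ?ker_normal ?subsetIl //.
  by apply: morphpreS; apply: sub1G.
apply: pnat_coprime pC _; rewrite /= -[X in #|X : _|]preE.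
by rewrite index_morphpre ?fE.
Qed.

Lemma central_p_split_index (gT : finGroupType) (G M : {group gT}) :
  M \subset G -> p^'.-nat #|G : M| -> central_p_split M -> central_p_split G.
Proof.
move=> sMG p'GM sM hT E f fE sCZ pC.
apply: (splits_preim fE sCZ pC sMG p'GM).
pose EM := (f @*^-1 M)%G.
have sEME : EM \subset E by rewrite subsetIl.
have sCE : 'ker f \subset EM by apply: morphpreS; apply: sub1G.
pose g := restrm_morphism sEME f.
have kg : 'ker g = 'ker f by rewrite ker_restrm; apply/setIidPr.
rewrite -kg; apply: sM; rewrite ?kg //.
  by rewrite morphim_restrm setIid morphpreK // fE.
apply/subsetP => x Cx; have := subsetP sCZ x Cx; case/centerP => Ex cx.
apply/centerP; split=> [|y Ey]; first by rewrite (subsetP sCE).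
by apply: cx; apply: subsetP sEME _ Ey.
Qed.

(** |M : M :&: K| equals |MK : K|, a divisor of |G : K|. *)
Lemma p_index_sub (gT : finGroupType) (G M K : {group gT}) :
  M \subset G -> K <| G -> p.-nat #|G : K| -> p.-nat #|M : M :&: K|.
Proof.
move=> sMG /andP[sKG nKG]; apply: pnat_dvd.
rewrite indexgI -indexMg -norm_joinEr ?(subset_trans sMG) //.
by apply: indexSg; [exact: joing_subl | rewrite join_subG sKG].
Qed.

Lemma p_perfect_sub (gT : finGroupType) (G M K : {group gT}) :
  p_perfect M -> M \subset G -> K <| G -> p.-nat #|G : K| -> M \subset K.
Proof.
move=> perM sMG nKG pGK.
suff: M \subset M :&: K by rewrite subsetI => /andP[].
apply: (perM (M :&: K)%G); last exact: p_index_sub pGK.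
exact: normalGI nKG.
Qed.

Lemma p_superperfect_index (gT : finGroupType) (G M : {group gT}) :
  M \subset G -> p^'.-nat #|G : M| -> p_superperfect M -> p_superperfect G.
Proof.
move=> sMG p'GM [s1 s2]; split; last exact: central_p_split_index p'GM s2.
move=> K nKG pGK.
have sMK : M \subset K by apply: p_perfect_sub s1 sMG nKG pGK.
rewrite -indexg_eq1 -[X in X == _](part_pnat_id pGK).
have p'GK : p^'.-nat #|G : K| by apply: pnat_dvd p'GM; apply: indexgS.
by rewrite part_p'nat.
Qed.

Lemma p_perfect_injm (gT hT : finGroupType) (E L : {group hT}) (f : {morphism E >-> gT}) :
  L \subset E -> 'ker f :&: L = 1 -> p_perfect (f @* L)%G -> p_perfect L.
Proof.
move=> sLE tiL perL K nKL pLK; have sKL := normal_sub nKL.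
have injf : 'injm (restrm sLE f) by rewrite ker_restrm setIC tiL.
have fK : f @* K = restrm sLE f @* K by rewrite morphim_restrm (setIidPr sKL).
have fL : f @* L = restrm sLE f @* L by rewrite morphim_restrm setIid.
have := perL (f @* K)%G; rewrite /= !fK !fL => /(_ (morphim_normal _ nKL)).
rewrite index_injm // => /(_ pLK); rewrite injmSK //.
Qed.

(** Splitting over N yields a complement L of the kernel in the preimage of N. Once L is normal in
    E, E / L is a central extension of G / N, and a complement there pulls back to one in E. *)
Lemma p_superperfect_ext (gT : finGroupType) (G N : {group gT}) :
  N <| G -> p_superperfect N -> p_superperfect (G / N) -> p_superperfect G.
Proof.
move=> nNG [N1 N2] [Q1 Q2]; split=> [K nKG pGK | hT E f fE sCZ pC].
  have [sNG nNGn] := andP nNG.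
  have sNK : N \subset K by apply: p_perfect_sub N1 sNG nKG pGK.
  rewrite -(quotientSGK nNGn sNK); apply: Q1; first exact: quotient_normal.
  by rewrite index_quotient_eq ?(normal_sub nKG) ?subIset ?sNK ?orbT.
have preE : f @*^-1 G = E by rewrite -fE morphimGK ?subsetIl.
have [sNG nNGn] := andP nNG.
pose EN := (f @*^-1 N)%G.
have nENE : EN <| E.
  by rewrite -[X in _ <| X]preE morphpre_normal ?fE.
have sCE : 'ker f \subset EN by apply: morphpreS; apply: sub1G.
have sEME := normal_sub nENE.
pose g := restrm_morphism sEME f.
have kg : 'ker g = 'ker f by rewrite ker_restrm; apply/setIidPr.
have gEN : g @* EN = N by rewrite morphim_restrm setIid morphpreK // fE.
have sCZN : 'ker f \subset 'Z(EN).
  apply/subsetP => x Cx; have := subsetP sCZ x Cx; case/centerP => Ex cx.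
  apply/centerP; split=> [|y Ey]; first by rewrite (subsetP sCE).
  by apply: cx; apply: subsetP sEME _ Ey.
have /splitsP[L /complP[tiL defEN]] : [splits EN, over 'ker f].
  by rewrite -kg; apply: N2; rewrite ?kg.
have sLEN : L \subset EN by rewrite -defEN mulG_subr.
have sLE := subset_trans sLEN sEME.
have fL : f @* L = N.
  rewrite -[RHS](morphpreK (_ : N \subset f @* E)) ?fE // -[f @*^-1 N]defEN.
  by rewrite morphimMl ?subsetIl // morphim_ker mul1g.
have perL : p_perfect L.
  apply: p_perfect_injm tiL _ => //.
  by rewrite (_ : (f @* L)%G = N) //; apply: val_inj.
(* The complement of the kernel in the preimage of N is unique, hence normal. *)
have nLE : L <| E.
  rewrite /normal sLE; apply/subsetP => x Ex; rewrite inE.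
  have sLx : L :^ x \subset EN.
    by rewrite -(normsP (normal_norm nENE) x Ex) conjSg.
  suff sub : L \subset L :^ x.
    by have /eqP <- : L == L :^ x :> {set _} by rewrite eqEcard sub cardJg leqnn.
  have defEx : 'ker f * (L :^ x) = EN.
    have <- : EN :^ x = EN by apply: (normsP (normal_norm nENE)).
    rewrite -[X in _ = X :^ _]defEN conjsMg.
    by congr (_ * _); rewrite (normsP (normal_norm (ker_normal f)) x Ex).
  have nLx : L :^ x <| EN.
    rewrite /normal sLx -[EN : {set _}]defEx mulG_subG normG andbT.
    apply: subset_trans (cent_sub _).
    apply: subset_trans sCZN _; rewrite subIset // (centS sLx) ?orbT //.
  (* Since EN is the product of the kernel and [L :^ x], the index of [L :^ x] is an index inside
     the kernel, hence a power of p. *)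
  apply: p_perfect_sub perL sLEN nLx _.
  rewrite (_ : #|EN : L :^ x| = #|'ker f : L :^ x|).
    by apply: pnat_dvd pC; apply: dvdn_indexg.
  apply/eqP; rewrite -(eqn_pmul2r (cardG_gt0 (L :^ x)%G)) !LagrangeMr.
  by rewrite mulGSid // defEx.
have sED : E \subset f @*^-1 'N(N).
  by rewrite -sub_morphim_pre ?subxx // fE.
(* [q] is f followed by reduction modulo N. Its kernel EN contains L, so it induces [g1] from E / L
   onto G / N, with kernel ['ker f / L]. *)
pose q := restrm_morphism sED [morphism of coset N \o f].
have kq : 'ker q = EN.
  rewrite ker_restrm ker_comp ker_coset; exact/setIidPr.
have sLq : 'ker (coset L) \subset 'ker q by rewrite ker_coset kq.
have nLEn := normal_norm nLE.
pose g1 := factm_morphism sLq nLEn.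
have kg1 : 'ker g1 = 'ker f / L.
  transitivity (EN / L); first by rewrite ker_factm kq.
  by rewrite -(quotientMidr L ('ker f)) defEN.
have [] := splitsP (Q2 _ _ g1 _ _ _).
- rewrite morphim_factm morphim_restrm setIid morphim_comp fE //.
- rewrite kg1 subsetI quotientS ?subsetIl //= quotient_cents //.
  by apply: subset_trans sCZ _; apply: subsetIr.
- by rewrite kg1 quotient_pgroup.
move=> R /complP[tiR defR].
have sRE : R \subset E / L by rewrite -[E / L]defR mulG_subr.
have [S defS sLS sSE] := inv_quotientS nLE sRE.
have tiS : 'ker f :&: S = 1.
  apply/trivgP; rewrite -tiL subsetI subsetIl /=.
  rewrite -quotient_sub1; last by rewrite subIset // (subset_trans sSE) ?orbT.
  rewrite -tiR kg1 defS; exact: quotientI.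
apply/splitsP; exists S; apply/complP; split=> //.
(* A count of orders: |E| = |L| |E / L|, where E / L is the product of ['ker g1] and S / L, and
   ['ker g1] is an image of ['ker f]. *)
apply/eqP; rewrite eqEcard mul_subG ?subsetIl //=.
rewrite TI_cardMg // -(Lagrange sLE) -card_quotient // -[E / L]defR TI_cardMg //.
rewrite /= kg1 defS (card_quotient (subset_trans sSE nLEn)) mulnCA Lagrange //.
by rewrite leq_mul2r leq_morphim orbT.
Qed.

End Superperfect.

(** * Groups of Heisenberg type *)

(** The solutions of y ^+ p = 1 form a subgroup of the abelian [<<S>>] containing its generators, so
    [<<S>>] is elementary abelian, of rank at most the number of generators. *)
Lemma card_gen_commuting (p : nat) (gT : finGroupType) (I : finType) (x : I -> gT) :
  prime p -> (forall i j, commute (x i) (x j)) -> (forall i, x i ^+ p = 1) ->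
  #|<<[set x i | i : I]>>| <= p ^ #|I|.
Proof.
move=> p_pr cx xp; set S := [set x i | i : I].
have cSS : abelian <<S>>.
  rewrite abelian_gen; apply/centsP => _ /imsetP[i _ ->] _ /imsetP[j _ ->].
  exact: cx.
have gL : group_set [set y in <<S>> | y ^+ p == 1].
  apply/group_setP; split=> [|y z]; first by rewrite inE group1 expg1n eqxx.
  rewrite !inE => /andP[Sy /eqP yp] /andP[Sz /eqP zp]; rewrite groupM //=.
  by rewrite expgMn ?yp ?zp ?mulg1 //; apply: (centsP cSS).
have sSL : <<S>> \subset Group gL.
  rewrite gen_subG; apply/subsetP => _ /imsetP[i _ ->].
  by rewrite inE xp eqxx andbT mem_gen ?imset_f.
have abS : p.-abelem <<S>>.
  apply/abelemP=> //; split=> // y /(subsetP sSL).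
  by rewrite inE => /andP[_ /eqP].
rewrite (card_pgroup (abelem_pgroup abS)) leq_exp2l ?prime_gt1 //.
rewrite -(rank_abelem abS) -grank_abelian ?(abelem_abelian abS) //.
by apply: leq_trans (grank_min _) _; apply: leq_imset_card.
Qed.

Section Heisenberg.

Variables (p : nat) (gT hT : finGroupType) (E : {group hT}).
Variable f : {morphism E >-> gT}.
Hypotheses (p_pr : prime p) (p_neq3 : p <> 3).
Hypotheses (sCZ : 'ker f \subset 'Z(E)) (pC : p.-group ('ker f)).

Let kerC x y : x \in 'ker f -> y \in E -> commute x y.
Proof. by move=> /(subsetP sCZ)/centerP[_ cx] /cx. Qed.

Let ker_expg x m : x \in 'ker f -> coprime p m -> x ^+ m = 1 -> x = 1.
Proof.
move=> Cx copm xm; apply/eqP; rewrite -order_eq1.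
have /p_natP[e oe] : p.-nat #[x] by apply: mem_p_elt pC Cx.
have : #[x] %| m by rewrite order_dvdn xm.
rewrite oe; case: e {oe} => // e.
by rewrite expnS => /(dvdn_trans (dvdn_mulr _ (dvdnn p))); rewrite prime_coprime // in copm; move/negP: copm.
Qed.

(** Any lift x satisfies x ^ w = x ^+ 2 * k with k in the central kernel, and x * k absorbs the
    error: both (x * k) ^ w and (x * k) ^+ 2 are x ^+ 2 * k ^+ 2. *)
Lemma lift_conj_sqr q w :
  q \in f @* E -> w \in E -> q ^ f w = q ^+ 2 ->
  exists x, [/\ x \in E, f x = q & x ^ w = x ^+ 2].
Proof.
move=> /morphimP[x Ex _ ->] Ew qw; pose k := x ^- 2 * x ^ w.
have Ck : k \in 'ker f.
  apply/kerP; rewrite ?groupM ?groupV ?groupX ?groupJ //.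
  by rewrite morphM ?groupV ?groupX ?groupJ // morphV ?groupX // morphX // morphJ // qw mulVg.
have Ek : k \in E by apply: (subsetP (subsetIl _ _)) Ck.
exists (x * k); split; first exact: groupM.
  by rewrite morphM // (mker Ck) ?mulg1.
have kw : k ^ w = k by apply/conjg_fixP/commgP; apply: kerC.
have cxk : commute x k by apply/commute_sym; apply: kerC.
by rewrite conjMg kw expgMn // -[x ^ w](mulKVg (x ^+ 2)) -/k -mulgA.
Qed.

(** The commutator of the lifts has trivial cube and lies in a p-group. This is where [p <> 3]
    enters. *)
Lemma commute_of_conj_sqr x y w :
  x \in E -> y \in E -> w \in E -> x ^ w = x ^+ 2 -> y ^ w = y ^+ 2 ->
  commute (f x) (f y) -> commute x y.
Proof.
move=> Ex Ey Ew xw yw cxy; apply/commgP/eqP; set k := [~ x, y].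
have Ck : k \in 'ker f.
  by apply/kerP; rewrite ?groupR // morphR //; apply/eqP/commgP.
have ckx : commute x k by apply/commute_sym/kerC.
have cky : commute y k by apply/commute_sym/kerC.
apply: (ker_expg (m := 3)) => //; first by rewrite prime_coprime // dvdn_prime2 //; apply/eqP.
have : k ^ w = k by apply/conjg_fixP/commgP; apply: kerC.
rewrite {1}/k conjRg xw yw commXg; last first.
  rewrite /commute commgX //. by apply: commuteX.
(* k is fixed by w and [x ^+ 2, y ^+ 2] = k ^+ 4, so k ^+ 3 = 1. *)
rewrite commgX // -expgM => k4; apply: (mulgI k); by rewrite -expgS mulg1.
Qed.

(** x ^+ p lies in the central kernel, so w fixes it, while conjugation by w also squares it. *)
Lemma expg1_of_conj_sqr x w :
  x \in E -> w \in E -> x ^ w = x ^+ 2 -> f x ^+ p = 1 -> x ^+ p = 1.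
Proof.
move=> Ex Ew xw xp.
have Ck : x ^+ p \in 'ker f by apply/kerP; rewrite ?groupX // morphX.
have : (x ^+ p) ^ w = x ^+ p by apply/conjg_fixP/commgP; apply: kerC.
rewrite conjXg xw -expgM mulnC expgM => k2.
by apply: (mulgI (x ^+ p)); rewrite mulg1; exact: k2.
Qed.

(** w fixes the central element [~ d, x]. As d ^ w differs from d by a central factor, conjugation
    by w also turns it into [~ d, x ^+ 2], its square. *)
Lemma commute_of_conj_fix d x w :
  d \in E -> x \in E -> w \in E -> x ^ w = x ^+ 2 -> f d ^ f w = f d ->
  commute (f d) (f x) -> commute d x.
Proof.
move=> Ed Ex Ew xw dw cdx; apply/commgP/eqP; set k := [~ d, x].
have Ck : k \in 'ker f.
  by apply/kerP; rewrite ?groupR // morphR //; apply/eqP/commgP.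
pose l := d ^ w * d^-1.
have Cl : l \in 'ker f.
  apply/kerP; rewrite ?groupM ?groupV ?groupJ // morphM ?groupV ?groupJ //.
  by rewrite morphV // morphJ // dw mulgV.
have : k ^ w = k by apply/conjg_fixP/commgP; apply: kerC.
rewrite {1}/k conjRg xw -[d ^ w](mulgKV d) -/l.
have -> : [~ l * d, x ^+ 2] = [~ d, x ^+ 2].
  rewrite commMgJ (_ : [~ l, x ^+ 2] = 1) ?conj1g ?mul1g //.
  by apply/eqP/commgP/kerC; rewrite ?groupX.
rewrite commgX; last by apply/commute_sym/kerC.
move=> k2; by apply: (mulgI k); rewrite mulg1; exact: k2.
Qed.


End Heisenberg.

(** The commutators of generators span a central elementary abelian group [<<D>>], and every element
    is a product from [<<D>>], [<<B>>] and [<<C>>] in this order. This will bound the group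
    generated by the lifts. *)
Lemma card_class2_gen (p : nat) (gT : finGroupType) (I J : finType)
    (b : I -> gT) (c : J -> gT) :
  prime p ->
  (forall i i', commute (b i) (b i')) -> (forall j j', commute (c j) (c j')) ->
  (forall i, b i ^+ p = 1) -> (forall j, c j ^+ p = 1) ->
  (forall i j i', commute [~ b i, c j] (b i')) ->
  (forall i j j', commute [~ b i, c j] (c j')) ->
  #|<<[set b i | i : I] :|: [set c j | j : J]>>|
    <= p ^ (#|I| + #|J| + #|I| * #|J|).
Proof.
move=> p_pr cb cc bp cp cdb cdc.
set B := [set b i | i : I]; set C := [set c j | j : J].
pose d (ij : I * J) := [~ b ij.1, c ij.2].
set D := [set d ij | ij : I * J].
have cDB : <<D>> \subset 'C(<<B>>).
  rewrite cent_gen gen_subG; apply/centsP => _ /imsetP[[i j] _ ->] _ /imsetP[i' _ ->].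
  exact: cdb.
have cDC : <<D>> \subset 'C(<<C>>).
  rewrite cent_gen gen_subG; apply/centsP => _ /imsetP[[i j] _ ->] _ /imsetP[j' _ ->].
  exact: cdc.
set W := <<B>> <*> <<C>>.
have cDW : <<D>> \subset 'C(W) by rewrite centY subsetI cDB.
have Bb i : b i \in <<B>> by rewrite mem_gen ?imset_f.
have Cc j : c j \in <<C>> by rewrite mem_gen ?imset_f.
have sDW : <<D>> \subset W.
  rewrite gen_subG; apply/subsetP => _ /imsetP[[i j] _ ->] /=.
  by rewrite groupR // mem_gen // inE (Bb, Cc) ?orbT.
have Dd ij : d ij \in <<D>> by rewrite mem_gen ?imset_f.
have cd ij kl : commute (d ij) (d kl).
  by apply: (centsP cDW); rewrite ?(subsetP sDW).
have dp ij : d ij ^+ p = 1.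
  by rewrite /d -commXg ?bp ?comm1g //; apply/commute_sym/cdb.
have nCV : <<C>> \subset 'N(<<D>> <*> <<B>>).
  rewrite gen_subG; apply/subsetP => _ /imsetP[j _ ->].
  rewrite inE conjYg join_subG; apply/andP; split.
    have /normP -> : c j \in 'N(<<D>>).
      by apply: (subsetP (cent_sub _)); apply: (subsetP (_ : <<C>> \subset _)) (Cc j); rewrite centsC.
    exact: joing_subl.
  rewrite -genJ gen_subG; apply/subsetP => _ /imsetP[_ /imsetP[i _ ->] ->].
  rewrite conjg_mulR groupM //; first by rewrite (subsetP (joing_subr _ _)).
  by rewrite (subsetP (joing_subl _ _)) // (Dd (i, j)).
have nBD : <<B>> \subset 'N(<<D>>) by apply: subset_trans (cent_sub _); rewrite centsC.
have sub : <<B :|: C>> \subset (<<D>> <*> <<B>>) * <<C>>.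
  rewrite -norm_joinEr // gen_subG subUset -[_ \subset _]gen_subG -[X in _ && X]gen_subG.
  by rewrite joing_subr (subset_trans (joing_subr <<D>> <<B>>)) ?joing_subl.
apply: leq_trans (subset_leq_card sub) _.
have cM (S T : {group gT}) : #|S * T| <= #|S| * #|T|.
  by rewrite mul_cardG leq_pmulr ?cardG_gt0.
apply: leq_trans (cM (<<D>> <*> <<B>>)%G <<C>>%G) _.
rewrite addnAC !expnD leq_mul //; last by apply: card_gen_commuting.
rewrite /= norm_joinEr //; apply: leq_trans (cM <<D>>%G <<B>>%G) _.
rewrite mulnC leq_mul //; first exact: card_gen_commuting.
by rewrite -card_prod; apply: card_gen_commuting.
Qed.

Lemma exp2_pnat_mod (p e : nat) : prime p -> 2 ^ (p ^ e) = 2 %[mod p].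
Proof.
move=> p_pr; elim: e => [|e IHe]; first by rewrite expn0 expn1.
by rewrite expnSr expnM fermat_little.
Qed.

(** If |Q : K| = p ^ e, then w ^+ (p ^ e) lies in K, and so does [~ x, w ^+ (p ^ e)] = x ^+ (2 ^ (p
    ^ e) - 1). By Fermat this exponent is 1 mod p, and x ^+ p = 1. *)
Lemma mem_p_index_of_conj_sqr (p : nat) (gT : finGroupType) (Q K : {group gT}) x w :
  prime p -> K <| Q -> p.-nat #|Q : K| -> x \in Q -> w \in Q ->
  x ^ w = x ^+ 2 -> x ^+ p = 1 -> x \in K.
Proof.
move=> p_pr /andP[sKQ nKQ] pQK Qx Qw xw xp.
have [e oe] := p_natP pQK.
have Kw : w ^+ (p ^ e) \in K.
  rewrite coset_idr ?groupX ?(subsetP nKQ) // morphX ?(subsetP nKQ) //.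
  by rewrite -oe -card_quotient // expg_cardG ?mem_quotient.
have xwm m : x ^ (w ^+ m) = x ^+ (2 ^ m).
  elim: m => [|m IHm]; first by rewrite expg0 conjg1.
  by rewrite expgSr conjgM IHm conjXg xw -expgM -expnS.
have Kx : x ^+ (2 ^ (p ^ e)).-1 \in K.
  have e2 : x * x ^+ (2 ^ (p ^ e)).-1 = x * [~ x, w ^+ (p ^ e)].
    by rewrite -expgS prednK ?expn_gt0 // -xwm conjg_mulR.
  rewrite (mulgI _ _ _ e2) commgEr groupM // memJ_norm ?groupV //.
  by rewrite (subsetP nKQ).
have cop : coprime #|<[x]>| (2 ^ (p ^ e)).-1.
  apply: (@coprime_dvdl _ p); first by rewrite order_dvdn xp.
  rewrite prime_coprime // -subn1 -eqn_mod_dvd ?expn_gt0 // exp2_pnat_mod //.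
  by rewrite eqn_mod_dvd // subn1 /= dvdn1; case: eqP p_pr => // ->.
by rewrite -(expgK cop (cycle_id x)) groupX.
Qed.

(** Conjugation by z or its inverse squares the generators. This forces them into each normal
    subgroup of p-power index, and it singles out lifts that generate a complement over H. *)
Lemma p_superperfect_heisenberg (p : nat) (gT : finGroupType) (Q : {group gT})
    (I J : finType) (b : I -> gT) (c : J -> gT) (z : gT) :
  let H := <<[set b i | i : I] :|: [set c j | j : J]>> in
  prime p -> odd p -> p <> 3 ->
  z \in Q -> (forall i, b i \in Q) -> (forall j, c j \in Q) ->
  (forall i i', commute (b i) (b i')) -> (forall j j', commute (c j) (c j')) ->
  (forall i, b i ^+ p = 1) -> (forall j, c j ^+ p = 1) ->
  (forall i j i', commute [~ b i, c j] (b i')) ->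
  (forall i j j', commute [~ b i, c j] (c j')) ->
  (forall i, b i ^ z = b i ^+ 2) -> (forall j, c j ^ z^-1 = c j ^+ 2) ->
  p^'.-nat #|Q : H| -> p ^ (#|I| + #|J| + #|I| * #|J|) <= #|H| ->
  p_superperfect p Q.
Proof.
move=> H p_pr p_odd p_neq3 Qz Qb Qc cb cc bp cp cdb cdc bz cz p'H leH.
have sHQ : H \subset Q.
  rewrite gen_subG subUset; apply/andP.
  by split; apply/subsetP => _ /imsetP[i _ ->].
split.
  move=> K /andP[sKQ nKQ] pQK.
  suff sHK : H \subset K.
    rewrite -indexg_eq1 -[X in X == _](part_pnat_id pQK) part_p'nat //.
    by apply: pnat_dvd p'H; apply: indexgS.
  have nKQ' : K <| Q by apply/andP.
  rewrite gen_subG subUset; apply/andP; split; apply/subsetP => _ /imsetP[i _ ->].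
    exact: (mem_p_index_of_conj_sqr p_pr nKQ' pQK _ Qz).
  by apply: (mem_p_index_of_conj_sqr (w := z^-1) p_pr nKQ' pQK); rewrite ?groupV.
move=> hT E f fE sCZ pC.
apply: (splits_preim fE sCZ pC sHQ p'H).
have [w Ew fw] : exists2 w, w \in E & f w = z.
  by move: Qz; rewrite -fE => /morphimP[w Ew _ ->]; exists w.
have fwV : f w^-1 = z^-1 by rewrite morphV // fw.
have lb i : exists x, [/\ x \in E, f x = b i & x ^ w = x ^+ 2].
  by apply: lift_conj_sqr => //; rewrite ?fE ?fw.
have lc j : exists x, [/\ x \in E, f x = c j & x ^ w^-1 = x ^+ 2].
  by apply: lift_conj_sqr => //; rewrite ?fE ?fwV ?groupV.
have [x xP] := fin_all_exists lb; have [y yP] := fin_all_exists lc.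
have Ewv : w^-1 \in E by rewrite groupV.
pose L := <<[set x i | i : I] :|: [set y j | j : J]>>%G.
(* z squares [b i] and sends [c j] to its square root [c j ^+ uphalf p], where uphalf p = (p + 1) /
   2 inverts 2 mod p. The commutator is bilinear here, so z fixes it. *)
have dz i j : [~ b i, c j] ^ z = [~ b i, c j].
  have e2 : (2 * uphalf p)%N = p.+1 by rewrite mul2n uphalfE even_halfK //= p_odd.
  have cjz : c j ^ z = c j ^+ uphalf p.
    rewrite -[in RHS](conjgKV z (c j)) cz conjXg -expgM e2 expgS -[_ ^+ p]conjXg.
    by rewrite cp conj1g mulg1.
  have cdV := commute_sym (cdc i j j); have cdV' := commute_sym (cdb i j i).
  rewrite conjRg bz cjz.
  have dm : [~ b i, c j ^+ uphalf p] = [~ b i, c j] ^+ uphalf p by rewrite commgX.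
  rewrite commXg dm; last exact: commuteX.
  by rewrite -expgM mulnC e2 expgS -[_ ^+ p]commXg // bp comm1g mulg1.
have fd i j : f [~ x i, y j] = [~ b i, c j].
  by have [? <- _] := xP i; have [? <- _] := yP j; rewrite morphR.
have sLE : L \subset E.
  rewrite gen_subG subUset; apply/andP.
  by split; apply/subsetP => _ /imsetP[i _ ->]; [case: (xP i) | case: (yP i)].
have fL : f @* L = H.
  apply/eqP; rewrite eqEsubset sub_morphim_pre // !gen_subG !subUset -!andbA.
  apply/and4P; split; apply/subsetP => _ /imsetP[i _ ->].
  - have [Ex fx _] := xP i.
    by rewrite mem_morphpre // fx mem_gen // inE imset_f.
  - have [Ey fy _] := yP i.
    by rewrite mem_morphpre // fy mem_gen // inE imset_f ?orbT.
  - have [Ex <- _] := xP i.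
    by rewrite mem_morphim // mem_gen // inE imset_f.
  - have [Ey <- _] := yP i.
    by rewrite mem_morphim // mem_gen // inE imset_f ?orbT.
(* The relations survive in the lifts, so L is no larger than H. *)
have leL : #|L| <= p ^ (#|I| + #|J| + #|I| * #|J|).
  apply: card_class2_gen => //.
  - move=> i i'; have [? e ?] := xP i; have [? e' ?] := xP i'.
    by apply: (commute_of_conj_sqr p_pr p_neq3 sCZ pC (w := w)); rewrite ?e ?e'.
  - move=> i i'; have [? e ?] := yP i; have [? e' ?] := yP i'.
    by apply: (commute_of_conj_sqr p_pr p_neq3 sCZ pC (w := w^-1)); rewrite ?e ?e'.
  - by move=> i; have [? e ?] := xP i; apply: (expg1_of_conj_sqr sCZ (w := w)); rewrite ?e.
  - by move=> i; have [? e ?] := yP i; apply: (expg1_of_conj_sqr sCZ (w := w^-1)); rewrite ?e.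
  - move=> i j i'; have [? e ?] := xP i; have [? e' ?] := yP j; have [? e'' ?] := xP i'.
    apply: (commute_of_conj_fix sCZ (w := w)) => //; rewrite ?groupR ?fd ?fw ?e'' //.
  - move=> i j j'; have [? e ?] := xP i; have [? e' ?] := yP j; have [? e'' ?] := yP j'.
    apply: (commute_of_conj_fix sCZ (w := w^-1)) => //; rewrite ?groupR ?fd ?fwV ?e'' //.
    by rewrite -{1}(dz i j) conjgK.
(* |L : L :&: 'ker f| = |f @* L| = |H| >= |L|, so the intersection is trivial. *)
have tiL : 'ker f :&: L = 1.
  rewrite setIC; apply/eqP; rewrite trivg_card_le1 /=.
  have := leq_trans leL leH; rewrite -fL card_morphim (setIidPr sLE) => le.
  by rewrite -(leq_pmul2r (indexg_gt0 L ('ker f))) LagrangeI mul1n.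
apply/splitsP; exists L; apply/complP; split=> //.
by rewrite -morphimK // fL.
Qed.

Import GRing.Theory.
Local Open Scope ring_scope.
Local Open Scope nat_scope.

(** * Automorphisms of finite abelian p-groups *)

Section AddAut.

Variable A : finZmodType.
Local Open Scope ring_scope.

(** Additive permutations make sense for an abstract [finZmodType]; [Aut_add_aut] identifies them
    with [Aut [set: A]] for the concrete group. *)
Definition add_aut_set : {set {perm A}} :=
  [set g : {perm A} | [forall x, forall y, g (x + y) == g x + g y]].

Lemma add_autP (g : {perm A}) :
  reflect (forall x y, g (x + y) = g x + g y) (g \in add_aut_set).
Proof.
rewrite inE; apply: (iffP forallP) => [h x y | h x].
  by have /forallP/(_ y)/eqP := h x.
by apply/forallP => y; rewrite h.
Qed.

Fact add_aut_group_set : group_set add_aut_set.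
Proof.
apply/group_setP; split=> [|g h /add_autP gD /add_autP hD].
  by apply/add_autP => x y; rewrite !perm1.
by apply/add_autP => x y; rewrite !permM gD hD.
Qed.

Canonical add_aut := Group add_aut_group_set.

Lemma add_autD g x y : g \in add_aut -> g (x + y) = g x + g y.
Proof. by move/add_autP. Qed.

Lemma add_aut0 g : g \in add_aut -> g 0 = 0.
Proof. by move=> Gg; apply: (addrI (g 0)); rewrite -add_autD // !addr0. Qed.

Lemma add_autN g x : g \in add_aut -> g (- x) = - g x.
Proof. by move=> Gg; apply: (addrI (g x)); rewrite -add_autD // !subrr add_aut0. Qed.

Lemma add_autB g x y : g \in add_aut -> g (x - y) = g x - g y.
Proof. by move=> Gg; rewrite add_autD // add_autN. Qed.

Lemma add_autMn g x m : g \in add_aut -> g (x *+ m) = g x *+ m.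
Proof.
move=> Gg; elim: m => [|m IHm]; first by rewrite !mulr0n add_aut0.
by rewrite !mulrS add_autD // IHm.
Qed.

Lemma add_aut_sum g (I : Type) (r : seq I) (P : pred I) (F : I -> A) :
  g \in add_aut -> g (\sum_(i <- r | P i) F i) = \sum_(i <- r | P i) g (F i).
Proof. by move=> Gg; apply: big_morph; [move=> x y; apply: add_autD | apply: add_aut0]. Qed.

Lemma add_aut_of_inj (f : A -> A) :
  {morph f : x y / x + y} -> (forall x, f x = 0 -> x = 0) ->
  exists2 g, g \in add_aut & forall x, g x = f x.
Proof.
move=> fD f0.
have injf : injective f.
  move=> x y fxy; apply/eqP; rewrite -subr_eq0; apply/eqP/f0/(addIr (f y)).
  by rewrite -fD subrK add0r.
by exists (perm injf) => [|x]; rewrite ?permE //; apply/add_autP => x y; rewrite !permE.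
Qed.

End AddAut.

(* The coordinate co i x only matters mod p ^ l i. Indices i >= n are harmless:
   the uses have l i = 0 there, which forces e i = 0. *)
Record pbasis (A : finZmodType) (p n : nat) (l : nat -> nat)
    (e : nat -> A) (co : nat -> A -> nat) : Prop := PBasis {
  pbasisD : forall i x y, co i (x + y)%R = co i x + co i y %[mod p ^ l i];
  pbasisE : forall i j, co i (e j) = (i == j) %[mod p ^ l i];
  pbasis_order : forall i, e i *+ (p ^ l i) = 0%R;
  pbasis_gen : forall x, x = (\sum_(i < n) e i *+ co i x)%R
}.

(** * Coordinates, flags and layers *)

Section Basis.

Variables (A : finZmodType) (p n : nat) (l : nat -> nat).
Variables (e : nat -> A) (co : nat -> A -> nat).
Hypotheses (p_pr : prime p) (Be : pbasis p n l e co).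
Hypothesis l_anti : forall i j, i <= j -> l j <= l i.
Hypothesis l_gt0 : forall i, i < n -> 0 < l i.

Let p_gt0 := prime_gt0 p_pr.
Let p_gt1 := prime_gt1 p_pr.

Lemma mulrn_congr (v : A) q m m' : v *+ q = 0%R -> m = m' %[mod q] -> v *+ m = v *+ m'.
Proof.
move=> vq e1; rewrite (divn_eq m q) (divn_eq m' q) e1 !mulrnDr.
by rewrite ![(_ * q)%N]mulnC !mulrnA vq !mul0rn.
Qed.

Lemma eqmodn_pexp i m a b : m <= l i -> a = b %[mod p ^ l i] -> a = b %[mod p ^ m].
Proof.
by move=> le e1; rewrite -(modn_dvdm a (dvdn_exp2l p le)) e1 modn_dvdm // dvdn_exp2l.
Qed.

Lemma co_mod i m x y : m <= l i -> co i (x + y)%R = co i x + co i y %[mod p ^ m].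
Proof. by move/eqmodn_pexp; apply; apply: pbasisD Be _ _ _. Qed.

Lemma co_e i j m : m <= l i -> co i (e j) = (i == j) %[mod p ^ m].
Proof. by move/eqmodn_pexp; apply; apply: pbasisE Be _ _. Qed.

Lemma co0 i m : m <= l i -> co i 0%R = 0 %[mod p ^ m].
Proof.
move=> le; apply/eqP; rewrite -(eqn_modDl (co i 0%R)) addn0; apply/eqP.
by rewrite -co_mod // addr0.
Qed.

Lemma coMn i m x k : m <= l i -> co i (x *+ k) = k * co i x %[mod p ^ m].
Proof.
move=> le; elim: k => [|k IHk]; first by rewrite mulr0n mul0n co0.
by rewrite mulrS co_mod // mulSn -modnDmr IHk modnDmr.
Qed.

Lemma co_sum i m (I : Type) (r : seq I) (P : pred I) (F : I -> A) :
  m <= l i -> co i (\sum_(j <- r | P j) F j)%R = \sum_(j <- r | P j) co i (F j) %[mod p ^ m].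
Proof.
move=> le; elim/big_ind2: _ => [|x a y b xa yb|//]; first exact: co0.
by rewrite co_mod // -modnDm xa yb modnDm.
Qed.

Lemma coB i m x y : m <= l i -> (p ^ m %| co i (x - y)%R) = (co i x == co i y %[mod p ^ m]).
Proof.
move=> le; rewrite -[co i y]add0n -{2}(subrK y x) co_mod // eqn_modDr.
by rewrite /dvdn mod0n.
Qed.

Lemma co_eq0 x : (forall i, i < n -> p ^ l i %| co i x) -> x = 0%R.
Proof.
move=> h; rewrite (pbasis_gen Be x); apply: big1 => i _.
by have /dvdnP[k ->] := h i (ltn_ord i); rewrite mulnC mulrnA (pbasis_order Be) mul0rn.
Qed.

Lemma mulrn_eq0P x m :
  reflect (forall i, i < n -> p ^ l i %| m * co i x) (x *+ m == 0%R).
Proof.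
apply: (iffP eqP) => [xm i ltin | h].
  by rewrite /dvdn -coMn // xm co0 // mod0n.
by apply: co_eq0 => i /h; rewrite /dvdn -coMn.
Qed.

(** In coordinates, the subgroup F_i = <e_a : a >= i> + pA. From i = 0 to n it descends from A to pA
    and induces a complete flag of A / pA. *)
Definition flag i := [set x | [forall a : 'I_i, p %| co a x]].

Lemma flagP i x : reflect (forall a, a < i -> p %| co a x) (x \in flag i).
Proof.
rewrite inE; apply: (iffP forallP) => [h a lt | h a]; last exact: h.
exact: (h (Ordinal lt)).
Qed.

Lemma flagS i j : i <= j -> flag j \subset flag i.
Proof.
move=> le; apply/subsetP => x /flagP h; apply/flagP => a lt.
by apply: h; apply: leq_trans lt le.
Qed.

Lemma flag0 i : i <= n -> 0%R \in flag i.
Proof.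
move=> le; apply/flagP => a lt; rewrite -(expn1 p) /dvdn co0 ?mod0n //.
by apply: l_gt0; apply: leq_trans le.
Qed.

Lemma flagB i x y : i <= n -> x \in flag i -> y \in flag i -> (x - y)%R \in flag i.
Proof.
move=> le /flagP Fx /flagP Fy; apply/flagP => a lt; rewrite -(expn1 p) coB.
  by rewrite expn1 (eqP (Fx a lt)) (eqP (Fy a lt)).
by apply: l_gt0; apply: leq_trans le.
Qed.

Lemma flagN i x : i <= n -> x \in flag i -> (- x)%R \in flag i.
Proof. by move=> le Fx; rewrite -[(- x)%R]add0r flagB ?flag0. Qed.

Lemma flagD i x y : i <= n -> x \in flag i -> y \in flag i -> (x + y)%R \in flag i.
Proof. by move=> le Fx Fy; rewrite -[y]opprK flagB ?flagN. Qed.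

Lemma flagMn i x m : i <= n -> x \in flag i -> x *+ m \in flag i.
Proof.
by move=> le Fx; elim: m => [|m IHm]; rewrite ?flag0 // mulrS flagD.
Qed.

Lemma flag_mulp i x : i <= n -> x *+ p \in flag i.
Proof.
move=> le; apply/flagP => a lt; rewrite -(expn1 p) /dvdn coMn ?expn1 ?modnMr //.
by apply: l_gt0; apply: leq_trans le.
Qed.

Lemma flagnP x : x \in flag n -> exists y, x = y *+ p.
Proof.
move/flagP => Fx; exists (\sum_(i < n) e i *+ (co i x %/ p))%R.
rewrite {1}(pbasis_gen Be x) -sumrMnl; apply: eq_bigr => i _.
by rewrite -mulrnA divnK // Fx.
Qed.

Lemma flag_e i j : i <= j -> i <= n -> e j \in flag i.
Proof.
move=> le len; apply/flagP => a lt; rewrite -(expn1 p) /dvdn co_e ?expn1.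
  by rewrite (ltn_eqF (leq_trans lt le)) mod0n.
by apply: l_gt0; apply: leq_trans len.
Qed.

(* If i is the last index of its exponent block, then layer i is generated modulo
   layer i.+1 by e i and the e b *+ p ^ (l b - l i) with l i < l b; otherwise it is
   generated by e i alone. *)
Definition layer i := [set x in flag i | x *+ (p ^ l i) == 0%R].

Lemma layerP i x : reflect (x \in flag i /\ x *+ (p ^ l i) = 0%R) (x \in layer i).
Proof.
rewrite [x \in layer i]inE.
by apply: (iffP andP) => -[Fx /eqP x0].
Qed.

Lemma layerS i j : i <= j -> layer j \subset layer i.
Proof.
move=> le; apply/subsetP => x /layerP[Fx x0]; apply/layerP; split.
  exact: (subsetP (flagS le)).
by rewrite -(subnKC (l_anti le)) expnD mulrnA x0 mul0rn.
Qed.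

Lemma layer0 i : i <= n -> 0%R \in layer i.
Proof. by move=> le; apply/layerP; rewrite flag0 // mul0rn. Qed.

Lemma layerB i x y : i <= n -> x \in layer i -> y \in layer i -> (x - y)%R \in layer i.
Proof.
move=> le /layerP[Fx x0] /layerP[Fy y0]; apply/layerP.
by rewrite flagB // mulrnBl x0 y0 subr0.
Qed.

Lemma layerN i x : i <= n -> x \in layer i -> (- x)%R \in layer i.
Proof. by move=> le Fx; rewrite -[(- x)%R]add0r layerB ?layer0. Qed.

Lemma layerD i x y : i <= n -> x \in layer i -> y \in layer i -> (x + y)%R \in layer i.
Proof. by move=> le Fx Fy; rewrite -[y]opprK layerB ?layerN. Qed.

Lemma layerMn i x m : i <= n -> x \in layer i -> x *+ m \in layer i.
Proof.
by move=> le Fx; elim: m => [|m IHm]; rewrite ?layer0 // mulrS layerD.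
Qed.

Lemma layer_sum i (I : Type) (r : seq I) (P : pred I) (F : I -> A) :
  i <= n -> (forall j, P j -> F j \in layer i) -> (\sum_(j <- r | P j) F j)%R \in layer i.
Proof.
move=> le FZ; elim/big_ind: _ => //; first exact: layer0.
by move=> x y; apply: layerD.
Qed.

Lemma layer_e i : i < n -> e i \in layer i.
Proof. by move=> lt; apply/layerP; rewrite flag_e ?(ltnW lt) // (pbasis_order Be). Qed.

(** * The stabilizer of the flag, preimage of a Borel subgroup of GL(A / pA) *)

Definition flag_stab_set : {set {perm A}} :=
  [set g in add_aut A | [forall i : 'I_n.+1, forall x in flag i, g x \in flag i]].

Lemma flag_stabP g :
  reflect (g \in add_aut A /\ forall i x, i <= n -> x \in flag i -> g x \in flag i)
          (g \in flag_stab_set).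
Proof.
rewrite [g \in flag_stab_set]inE; apply: (iffP andP) => [[Gg /forallP h] | [Gg h]]; split=> //.
  move=> i x le Fx; have lt : i < n.+1 by [].
  by have /forall_inP/(_ _ Fx) := h (Ordinal lt).
by apply/forallP => i; apply/forall_inP => x; apply: h; rewrite -ltnS.
Qed.

Fact flag_stab_group_set : group_set flag_stab_set.
Proof.
apply/group_setP; split=> [|g h /flag_stabP[Gg gF] /flag_stabP[Gh hF]].
  by apply/flag_stabP; split=> [|i x _]; rewrite ?group1 ?perm1.
apply/flag_stabP; split=> [|i x le Fx]; first exact: groupM.
by rewrite permM hF ?gF.
Qed.
Canonical flag_stab := Group flag_stab_group_set.

Lemma flag_stab_add g : g \in flag_stab -> g \in add_aut A.
Proof. by case/flag_stabP. Qed.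

Lemma flag_stab_layer g i x : g \in flag_stab -> i <= n -> x \in layer i -> g x \in layer i.
Proof.
case/flag_stabP=> Gg gF le /layerP[Fx x0]; apply/layerP.
by rewrite gF // -add_autMn // x0 add_aut0.
Qed.

(** The kernel of the action of [flag_stab] on A / Z_i, where Z_i is [layer i]. *)
Definition layer_ker_set i : {set {perm A}} :=
  [set g in flag_stab | [forall x, (g x - x)%R \in layer i]].

Lemma layer_kerP i g :
  reflect (g \in flag_stab /\ forall x, (g x - x)%R \in layer i) (g \in layer_ker_set i).
Proof.
by rewrite [g \in layer_ker_set i]inE; apply: (iffP andP) => -[Mg /forallP].
Qed.

Fact layer_ker_group_set i : i <= n -> group_set (layer_ker_set i).
Proof.
move=> le; apply/group_setP; split=> [|g h /layer_kerP[Mg gZ] /layer_kerP[Mh hZ]].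
  by apply/layer_kerP; split=> [|x]; rewrite ?group1 // perm1 subrr layer0.
apply/layer_kerP; split=> [|x]; first exact: groupM.
by rewrite permM -(subrK (g x) (h _)) -addrA layerD.
Qed.

(* Generating makes this a group for all i; nothing is added when i <= n. *)
Definition layer_ker i : {group {perm A}} := <<layer_ker_set i>>%G.

Lemma layer_kerE i : i <= n -> layer_ker i = layer_ker_set i :> {set _}.
Proof. by move=> le; apply: (gen_set_id (layer_ker_group_set le)). Qed.

Lemma mem_layer_ker i g : i <= n ->
  reflect (g \in flag_stab /\ forall x, (g x - x)%R \in layer i) (g \in layer_ker i).
Proof. by move=> le; rewrite layer_kerE //; apply: layer_kerP. Qed.

Lemma layer_ker_normal i : i <= n -> layer_ker i <| flag_stab.
Proof.
move=> le; apply/andP; split.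
  by apply/subsetP => g /(mem_layer_ker _ le)[].
apply/subsetP => h Mh; rewrite inE; apply/subsetP => _ /imsetP[g Kg ->].
have [Mg gZ] := mem_layer_ker _ le Kg.
apply/mem_layer_ker => //; split=> [|x]; first by rewrite groupJ.
have Gh := flag_stab_add Mh.
rewrite !permM -{2}(permKV h x) -add_autB //.
exact: flag_stab_layer.
Qed.

Lemma layer_ker_sub i : i <= n -> layer_ker i \subset flag_stab.
Proof. by move/layer_ker_normal/normal_sub. Qed.

Lemma layer_kerS i j : i <= j -> j <= n -> layer_ker j \subset layer_ker i.
Proof.
move=> le ltn; have len := leq_trans le ltn.
apply/subsetP => g /(mem_layer_ker _ ltn)[Mg gZ]; apply/mem_layer_ker => //.
by split=> // x; apply: (subsetP (layerS le)).
Qed.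

(** Z_i is stable under h and its inverse, so g * h^-1 is trivial modulo Z_i exactly when g and h
    agree modulo Z_i. Equalities in the quotient become pointwise congruences. *)
Lemma coset_layer_ker i g h : i <= n -> g \in flag_stab -> h \in flag_stab ->
  reflect (forall x, (g x - h x)%R \in layer i)
          (coset (layer_ker i) g == coset (layer_ker i) h).
Proof.
move=> le Mg Mh; have [_ /subsetP nKM] := andP (layer_ker_normal le).
have -> : (coset (layer_ker i) g == coset (layer_ker i) h) = (g * h^-1 \in layer_ker i)%g.
  apply/eqP/idP => [e1 | Kgh].
    by rewrite coset_idr ?groupM ?groupV ?nKM // morphM ?groupV ?nKM // morphV ?nKM //= e1 mulgV.
  by rewrite -[g in LHS](mulgKV h) morphM ?groupM ?groupV ?nKM //= (coset_id Kgh) mul1g.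
have Mhv : (h^-1)%g \in flag_stab by rewrite groupV.
have Ghv := flag_stab_add Mhv; have Gh := flag_stab_add Mh.
apply: (iffP (mem_layer_ker _ le)) => [[_ ghZ] x | ghZ].
  have := flag_stab_layer Mh le (ghZ x).
  by rewrite permM add_autB // permKV.
split=> [|x]; first by rewrite groupM.
by rewrite permM -{2}(permK h x) -add_autB // flag_stab_layer.
Qed.

(* Junk value 1 when x |-> x + v *+ co a x is not an automorphism. *)
Definition transvection a v : {perm A} :=
  odflt 1%g [pick g in add_aut A | [forall x, g x == x + v *+ co a x]%R].

(** If x + v *+ co a x = 0, its a-th coordinate gives (1 + co a v) * co a x = 0 mod p ^ l a. The
    first factor is a unit, so v *+ co a x = 0 and x = 0. *)
Lemma transvectionP a v :
  a < n -> v *+ p ^ l a = 0%R -> coprime p (1 + co a v) ->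
  transvection a v \in add_aut A /\ (forall x, transvection a v x = x + v *+ co a x)%R.
Proof.
move=> lt v0 cop; rewrite /transvection; case: pickP => [g /andP[Gg /forallP gE] | no] /=.
  by split=> // x; apply/eqP.
have fD : {morph (fun x => x + v *+ co a x)%R : x y / (x + y)%R}.
  by move=> x y; rewrite (mulrn_congr v0 (pbasisD Be a x y)) mulrnDr addrACA.
have f0 x : (x + v *+ co a x = 0 -> x = 0)%R.
  move=> x0; have : p ^ l a %| co a x.
    have : p ^ l a %| co a (x + v *+ co a x)%R by rewrite x0 /dvdn co0 ?mod0n.
    rewrite /dvdn co_mod // -modnDmr coMn // modnDmr -[X in X + _]muln1 -mulnDr.
    by rewrite -/(dvdn _ _) Gauss_dvdl // coprimeXl.
  by case/dvdnP=> k xk; move: x0; rewrite xk mulnC mulrnA v0 mul0rn addr0.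
have [g Gg gE] := add_aut_of_inj fD f0.
by have := no g; rewrite Gg /=; move/negbT/forallP=> []; move=> x; rewrite gE.
Qed.

(** Let x be in F_i. If a < i, then p divides co a x and the added multiple of v lies in pA; if i <=
    a, it lies in F_a, hence in F_i. *)
Lemma transvection_flag_stab a v :
  a < n -> v *+ p ^ l a = 0%R -> coprime p (1 + co a v) -> v \in flag a ->
  transvection a v \in flag_stab.
Proof.
move=> lt v0 cop Fv; have [Gt tE] := transvectionP lt v0 cop.
apply/flag_stabP; split=> // i x le Fx; rewrite tE flagD //.
case: (ltnP a i) => [lti | lei]; last by rewrite flagMn // (subsetP (flagS lei)).
by have /dvdnP[k ->] := flagP _ _ Fx a lti; rewrite mulrnA flag_mulp.
Qed.

Lemma layer_transvection a i v :
  a <= i -> i < n -> v \in layer i -> coprime p (1 + co a v) ->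
  transvection a v \in layer_ker i /\ (forall x, transvection a v x = x + v *+ co a x)%R.
Proof.
move=> le lt Zv cop; have lta := leq_ltn_trans le lt.
have [Fv v0] := layerP _ _ Zv.
have v0a : v *+ p ^ l a = 0%R.
  by rewrite -(subnKC (l_anti le)) expnD mulrnA v0 mul0rn.
have [Gt tE] := transvectionP lta v0a cop; split=> //.
apply/mem_layer_ker; first exact: ltnW.
split=> [|x]; last by rewrite tE addrC addKr layerMn // ltnW.
by apply: transvection_flag_stab => //; apply: (subsetP (flagS le)).
Qed.

Lemma add_aut_eq_basis i (g h : {perm A}) :
  i <= n -> g \in add_aut A -> h \in add_aut A ->
  (forall a, a < n -> (g (e a) - h (e a))%R \in layer i) ->
  forall x, (g x - h x)%R \in layer i.
Proof.
move=> le Gg Gh ghZ x; rewrite (pbasis_gen Be x) !add_aut_sum // -sumrB.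
apply: layer_sum => // a _; rewrite !add_autMn // -mulrnBl layerMn //.
exact: ghZ.
Qed.

Hypotheses (p_odd : odd p) (p_neq3 : p <> 3) (l_n : l n = 0).
Hypothesis l_gap : forall i, i < n -> l i <= (l i.+1).+1.

(** The gap condition enters here: it makes Z_i / Z_(i+1) elementary abelian. *)
Lemma layer_mulp i x : i < n -> x \in layer i -> x *+ p \in layer i.+1.
Proof.
move=> lt /layerP[Fx x0]; apply/layerP; rewrite flag_mulp //; split=> //.
by rewrite -mulrnA -expnS -(subnKC (l_gap lt)) expnD mulrnA x0 mul0rn.
Qed.

(** * The quotient K_i / K_(i+1) *)

Section Step.

Variable i : nat.
Hypothesis lt_in : i < n.
Let le_in := ltnW lt_in.

Let K := layer_ker i.+1.
Let Q := (layer_ker i / K)%G.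

Lemma layer_mul_dvdn v m : v \in layer i -> p %| m -> v *+ m \in layer i.+1.
Proof.
by move=> Zv /dvdnP[k ->]; rewrite mulnC mulrnA layerMn // layer_mulp.
Qed.

Lemma co_modp a x y : a <= i -> co a (x + y)%R = co a x + co a y %[mod p].
Proof.
move=> le; rewrite -(expn1 p); apply: co_mod.
by apply: l_gt0; apply: leq_ltn_trans lt_in.
Qed.

Lemma coMn_modp a x k : a <= i -> co a (x *+ k)%R = k * co a x %[mod p].
Proof.
move=> le; rewrite -(expn1 p); apply: coMn.
by apply: l_gt0; apply: leq_ltn_trans lt_in.
Qed.

Lemma co_e_modp a b : a <= i -> co a (e b) = (a == b) %[mod p].
Proof.
move=> le; rewrite -(expn1 p); apply: co_e.
by apply: l_gt0; apply: leq_ltn_trans lt_in.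
Qed.

Lemma co_sum_modp a (I : Type) (r : seq I) (P : pred I) (F : I -> A) : a <= i ->
  co a (\sum_(j <- r | P j) F j)%R = \sum_(j <- r | P j) co a (F j) %[mod p].
Proof.
move=> le; rewrite -[X in _ %% X](expn1 p) -[X in _ = _ %% X](expn1 p); apply: co_sum.
by apply: l_gt0; apply: leq_ltn_trans lt_in.
Qed.

Lemma coB_modp a x y : a <= i -> (p %| co a (x - y)%R) = (co a x == co a y %[mod p]).
Proof.
move=> le; have := @coB a 1 x y; rewrite expn1; apply.
by apply: l_gt0; apply: leq_ltn_trans lt_in.
Qed.

Let eqZ x y := (x - y)%R \in layer i.+1.

Let eqZxx x : eqZ x x. Proof. by rewrite /eqZ subrr layer0. Qed.

Let eqZ_trans y x z : eqZ x y -> eqZ y z -> eqZ x z.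
Proof. by move=> xy yz; rewrite /eqZ -(subrK y x) -addrA layerD. Qed.

Let eqZ_sym x y : eqZ x y -> eqZ y x.
Proof. by move=> xy; rewrite /eqZ -opprB layerN. Qed.

Let eqZD x y x' y' : eqZ x y -> eqZ x' y' -> eqZ (x + x')%R (y + y')%R.
Proof. by move=> xy xy'; rewrite /eqZ opprD addrACA layerD. Qed.

Let eqZ_addl x y y' : eqZ (x + y)%R (x + y')%R -> eqZ y y'.
Proof. by rewrite /eqZ opprD addrACA subrr add0r. Qed.

Let eqZ_mul v m m' : v \in layer i -> m = m' %[mod p] -> eqZ (v *+ m) (v *+ m').
Proof.
move=> Zv; wlog le : m m' / m' <= m => [hw | mm'].
  by case: (leqP m' m) => [/hw | /ltnW /hw h mm']; [apply | apply: eqZ_sym; apply: h].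
rewrite /eqZ -mulrnBr // layer_mul_dvdn //.
by rewrite -eqn_mod_dvd //; apply/eqP.
Qed.

Let T := transvection.
Let cT a v := coset K (T a v).

(** The last condition restricts v only for a = i: elements of Z_i have all coordinates before i
    divisible by p. *)
Let unip a v := [/\ a <= i, v \in layer i & p %| co a v].

Let unip_lt a v : a < i -> v \in layer i -> unip a v.
Proof. by move=> lt Zv; split=> //; [exact: ltnW | case/layerP: Zv => /flagP h _; apply: h]. Qed.

Let unip_T a v : unip a v -> T a v \in layer_ker i /\ (forall x, T a v x = x + v *+ co a x)%R.
Proof.
case=> le Zv dv; apply: layer_transvection => //.
rewrite prime_coprime //; apply/negP; rewrite dvdn_addl // dvdn1.
by case: eqP p_gt1 => // ->.
Qed.

Let unipD a v v' : unip a v -> unip a v' -> unip a (v + v')%R.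
Proof.
case=> le Zv dv [_ Zv' dv']; split; rewrite ?layerD //.
by rewrite /dvdn co_modp // -/(dvdn _ _) dvdn_add.
Qed.

Let unip0 a : a <= i -> unip a 0%R.
Proof.
move=> le; split; rewrite ?layer0 // -(expn1 p) /dvdn co0 ?mod0n //.
by apply: l_gt0; apply: leq_ltn_trans lt_in.
Qed.

Let unipMn a v k : unip a v -> unip a (v *+ k).
Proof.
move=> gv; elim: k => [|k IHk]; rewrite ?mulr0n ?mulrS; last exact: unipD.
by apply: unip0; case: gv.
Qed.

Let KM g : g \in layer_ker i -> g \in flag_stab.
Proof. exact: (subsetP (layer_ker_sub le_in)). Qed.

Let KNM g : g \in layer_ker i -> g \in 'N(K).
Proof. by move/KM; apply: (subsetP (normal_norm (layer_ker_normal lt_in))). Qed.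

Let cosetKP g h : g \in layer_ker i -> h \in layer_ker i ->
  (forall x, eqZ (g x) (h x)) -> coset K g = coset K h.
Proof. by move=> Kg Kh gh; apply/eqP/coset_layer_ker; rewrite ?KM. Qed.

Let cosetM g h : g \in layer_ker i -> h \in layer_ker i ->
  coset K (g * h)%g = (coset K g * coset K h)%g.
Proof. by move=> Kg Kh; rewrite morphM ?KNM. Qed.

(* Modulo the next layer, only the classes mod p of the coordinates matter. *)
Let T_mulE (g : {perm A}) a v x m : unip a v -> co a (g x) = m %[mod p] ->
  eqZ ((g * T a v)%g x) (g x + v *+ m)%R.
Proof.
move=> gv gm; have [_ Zv _] := gv; have [_ TE] := unip_T gv.
by rewrite permM TE; apply: eqZD => //; apply: eqZ_mul.
Qed.

(** Permutations compose from left to right: [T a' v'] acts first, so the coordinate read by [T a v]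
    has already changed by co a' x * co a v'. *)
Let T_mul2E a v a' v' x m : unip a v -> unip a' v' ->
  co a x + co a' x * co a v' = m %[mod p] ->
  eqZ ((T a' v' * T a v)%g x) (x + v' *+ co a' x + v *+ m)%R.
Proof.
move=> gv gv' mE; have [_ TE'] := unip_T gv'; have [le Zv _] := gv.
rewrite -TE'; apply: T_mulE => //; rewrite TE' co_modp // -modnDmr coMn_modp //.
by rewrite modnDmr.
Qed.

(** The correction term of [T_mul2E] vanishes mod p because p divides co a v. *)
Let T_add a v v' : unip a v -> unip a v' -> cT a (v + v')%R = (cT a v * cT a v')%g.
Proof.
move=> gv gv'; have [K1 _] := unip_T gv; have [K2 _] := unip_T gv'.
have [K3 TE] := unip_T (unipD gv gv').
rewrite /cT -cosetM //; apply: cosetKP; rewrite ?groupM // => x.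
apply: eqZ_sym; apply: eqZ_trans (T_mul2E (m := co a x) gv' gv _) _.
  by case: gv => _ _ /dvdnP[k ->]; rewrite mulnA -modnDmr modnMl addn0.
by rewrite TE mulrnDl addrA.
Qed.

Let T_layer a v : unip a v -> v \in layer i.+1 -> cT a v = 1%g.
Proof.
move=> gv Zv; have [K1 TE] := unip_T gv.
rewrite -[RHS](coset_id (group1 K)); apply: cosetKP => // x.
by rewrite perm1 TE /eqZ addrC addKr layerMn.
Qed.

Let T_exp a v k : unip a v -> (cT a v ^+ k)%g = cT a (v *+ k).
Proof.
move=> gv; elim: k => [|k IHk].
  by rewrite mulr0n expg0 T_layer ?layer0 //; apply: unip0; case: gv.
by rewrite mulrS expgS IHk T_add //; apply: unipMn.
Qed.

Let T_expp a v : unip a v -> (cT a v ^+ p)%g = 1%g.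
Proof.
by move=> gv; rewrite T_exp // T_layer //; [apply: unipMn | apply: layer_mulp => //; case: gv].
Qed.

Let T_commute a v a' v' : unip a v -> unip a' v' ->
  p %| co a v' -> p %| co a' v -> commute (cT a v) (cT a' v').
Proof.
move=> gv gv' /dvdnP[k d1] /dvdnP[k' d2].
have [K1 _] := unip_T gv; have [K2 _] := unip_T gv'.
rewrite /commute -!cosetM //; apply: cosetKP; rewrite ?groupM // => x.
apply: eqZ_trans (T_mul2E (m := co a' x) gv' gv _) _.
  by rewrite d2 mulnA -modnDmr modnMl addn0.
rewrite addrAC; apply: eqZ_sym; apply: T_mul2E => //.
by rewrite d1 mulnA -modnDmr modnMl addn0.
Qed.

(** The condition [l i.+1 < l i] does not involve b: it empties J unless i ends its block of equal
    exponents. *)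
Let J : finType := {b : 'I_i | (l i.+1 < l i) && (l i < l b)}.
Let vv (b : J) := e (val b) *+ p ^ (l (val b) - l i).

Let J_lt (b : J) : l i < l (val b). Proof. by case/andP: (valP b). Qed.

Let vv_layer b : vv b \in layer i.
Proof.
apply/layerP; rewrite /vv; split.
  by have := J_lt b; rewrite -subn_gt0 => /prednK <-; rewrite expnSr mulrnA flag_mulp.
by rewrite -mulrnA -expnD subnK ?(pbasis_order Be) // ltnW // J_lt.
Qed.

Let co_vv a b : a <= i -> p %| co a (vv b).
Proof.
move=> le; rewrite /dvdn coMn_modp // -modnMml.
by have := J_lt b; rewrite -subn_gt0 => /prednK <-; rewrite expnS modnMr mod0n.
Qed.

(** A transversal of Z_(i+1) in Z_i, by [yv_inj] and [layer_yv]; the quotient thus has order p ^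
    (|J| + 1). *)
Let yv (d : {ffun J -> 'I_p}) (c : 'I_p) := (\sum_b vv b *+ d b + e i *+ c)%R.

Let yv_layer d c : yv d c \in layer i.
Proof.
rewrite /yv layerD ?layerMn ?layer_e //; apply: layer_sum => // b _.
exact: layerMn.
Qed.

Let co_yv d c : co i (yv d c) = c %[mod p].
Proof.
have d0 : p %| co i (\sum_b vv b *+ d b)%R.
  rewrite /dvdn co_sum_modp // -/(dvdn _ _); apply: dvdn_sum => b _.
  by rewrite /dvdn coMn_modp // -modnMmr (eqP (co_vv _ _)) // muln0 mod0n.
rewrite /yv co_modp // -modnDmr coMn_modp // -modnMmr co_e_modp // modnMmr eqxx muln1 modnDmr.
by rewrite -modnDml (eqP d0).
Qed.

Let co_yv_J d c (b : J) :
  co (val b) (yv d c) = p ^ (l (val b) - l i) * d b %[mod p ^ (l (val b) - l i).+1].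
Proof.
have lb := J_lt b; have ltb : val b < i by [].
have le : (l (val b) - l i).+1 <= l (val b).
  rewrite -subSn ?(ltnW lb) // leq_subLR -add1n leq_add2r.
  by apply: l_gt0.
have d0 : p ^ (l (val b) - l i).+1 %| \sum_(b' | b' != b) co (val b) (vv b' *+ d b')%R.
  apply: dvdn_sum => b' nb; rewrite /dvdn coMn // -modnMmr /vv coMn // -[X in _ * X]modnMmr co_e //.
  have -> : (val b == val b' :> nat) = false by apply/negbTE; rewrite eq_sym.
  by rewrite mod0n muln0 mod0n muln0 mod0n.
rewrite /yv co_mod // -modnDmr coMn // -modnMmr co_e // modnMmr.
rewrite (ltn_eqF ltb) muln0 modnDmr addn0 co_sum // (bigD1 b) //= -modnDmr (eqP d0) addn0.
rewrite coMn // -modnMmr /vv coMn // -[X in _ * X]modnMmr co_e //.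
by rewrite modnMmr mulnA modnMmr eqxx muln1 mulnC.
Qed.

Let dvd_layer_exp b m : l i.+1 < l i -> l i < l b ->
  (p ^ l b %| p ^ l i.+1 * m) = (p ^ (l b - l i).+1 %| m).
Proof.
move=> lt1 lt2; have li : l i = (l i.+1).+1 by apply/eqP; rewrite eqn_leq lt1 l_gap.
have {1}-> : l b = l i.+1 + (l b - l i).+1 by rewrite addnS -addSn -li subnKC // ltnW.
by rewrite expnD dvdn_pmul2l ?expn_gt0 ?p_gt0.
Qed.

Let yv_inj d c d' c' : eqZ (yv d c) (yv d' c') -> d = d' /\ c = c'.
Proof.
case/layerP=> /flagP Fy y0; split; last first.
  have := Fy i (ltnSn i); rewrite coB_modp //.
  by rewrite !co_yv => /eqP; rewrite !modn_small // => /val_inj.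
apply/ffunP => b; apply: val_inj => /=.
have lb := J_lt b; have lt1 : l i.+1 < l i by case/andP: (valP b).
have ltb : val b < n by apply: ltn_trans lt_in.
(* The difference is killed by p ^ l i.+1, which fixes its b-th coordinate modulo p ^ (l b - l
   i).+1, one digit beyond p ^ (l b - l i). That digit is [d b]. *)
have := elimT (mulrn_eq0P _ _) (introT eqP y0) _ ltb.
rewrite dvd_layer_exp // coB; last by rewrite ltn_subrL l_gt0 // l_gt0.
rewrite !co_yv_J expnSr -!muln_modr eqn_pmul2l ?expn_gt0 ?p_gt0 // => /eqP.
by rewrite !modn_small.
Qed.

Let layer_yv y : y \in layer i -> exists dc, eqZ y (yv dc.1 dc.2).
Proof.
move=> Zy; have [Fy y0] := layerP _ _ Zy.
(* Torsion makes the b-th coordinate of y divisible by p ^ (l b - l i); [d b] is the next digit, and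
   c is the last digit of the i-th coordinate. *)
pose d := [ffun b : J => Ordinal (ltn_pmod (co (val b) y %/ p ^ (l (val b) - l i)) p_gt0)].
pose c := Ordinal (ltn_pmod (co i y) p_gt0).
exists (d, c) => /=; rewrite /eqZ.
have Zw : (y - yv d c)%R \in layer i by rewrite layerB.
have [Fw w0] := layerP _ _ Zw.
have Fw1 : (y - yv d c)%R \in flag i.+1.
  apply/flagP => a; rewrite ltnS leq_eqVlt => /orP[/eqP -> | ]; last exact: (flagP _ _ Fw).
  by rewrite coB_modp // co_yv /= modn_mod.
apply/layerP; split=> //.
case: (ltnP (l i.+1) (l i)) => [lt1 | le1]; last first.
  by rewrite -(subnKC le1) expnD mulrnA w0 mul0rn.
apply/eqP/mulrn_eq0P => b ltb.
case: (leqP (l b) (l i.+1)) => [leb | gtb].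
  by rewrite dvdn_mulr // dvdn_exp2l.
have li : l i = (l i.+1).+1 by apply/eqP; rewrite eqn_leq lt1 l_gap.
have leb : b <= i.
  by rewrite leqNgt; apply/negP => /l_anti; rewrite leqNgt gtb.
(* If l i < l b, the digit [d b] was chosen for this. If l b < l i, a gap of one contradicts l i.+1
   < l b. If they are equal, divisibility of the coordinate by p suffices, and that is membership in
   F_(i+1). *)
case: (ltngtP (l i) (l b)) => [lt2 | lt2 | e2].
- have nb : b < i by rewrite ltn_neqAle leb andbT; apply: contraTneq lt2 => ->; rewrite ltnn.
  have Jb : (l i.+1 < l i) && (l i < l (Ordinal nb)) by rewrite lt1.
  pose b' : J := Sub (Ordinal nb) Jb.
  rewrite dvd_layer_exp // coB; last by rewrite ltn_subrL l_gt0 // l_gt0.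
  rewrite (co_yv_J d c b') ffunE /= expnSr -muln_modr modn_mod muln_modr.
  rewrite [p ^ _ * (_ %/ _)]mulnC divnK // -(dvdn_pmul2l (p := p ^ l i)) ?expn_gt0 ?p_gt0 // -expnD.
  rewrite subnKC ?(ltnW lt2) //.
  by apply: (elimT (mulrn_eq0P _ _) (introT eqP y0)).
- by move: lt2; rewrite li ltnS leqNgt gtb.
- rewrite -e2 li expnSr dvdn_pmul2l ?expn_gt0 ?p_gt0 //.
  exact: (flagP _ _ Fw1).
Qed.

(** These play the parts of b, c and z in [p_superperfect_heisenberg]; [zz] doubles e_i. *)
Let beta (a : 'I_i) := cT a (e i).
Let gamma (b : J) := cT i (vv b).
Let zz := T i (e i).
Let H := <<[set beta a | a : 'I_i] :|: [set gamma b | b : J]>>.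

Let unip_beta (a : 'I_i) : unip a (e i).
Proof. by apply: unip_lt => //; apply: layer_e. Qed.

Let unip_gamma b : unip i (vv b).
Proof. by split=> //; apply: co_vv. Qed.

Let unip_delta (a : 'I_i) b : unip a (vv b).
Proof. by apply: unip_lt => //; apply: vv_layer. Qed.

Let co_beta (a : 'I_i) : p %| co a (e i).
Proof. by rewrite /dvdn co_e_modp 1?ltnW // (ltn_eqF (ltn_ord _)) mod0n. Qed.

Let zP : zz \in layer_ker i /\ (forall x, zz x = x + e i *+ co i x)%R.
Proof.
apply: layer_transvection; rewrite ?layer_e //.
rewrite prime_coprime // /dvdn -modnDmr co_e_modp // eqxx modnDmr -/(dvdn _ _).
by rewrite dvdn_prime2 //; case: eqP p_odd => // ->.
Qed.

Let mul_zE (g : {perm A}) x m : co i (g x) = m %[mod p] ->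
  eqZ ((g * zz)%g x) (g x + e i *+ m)%R.
Proof.
move=> gm; rewrite permM; have [_ ->] := zP.
by apply: eqZD => //; apply: eqZ_mul => //; apply: layer_e.
Qed.

(** The commutator relation of elementary matrices, modulo K_(i+1): adding e_i to e_a and [vv b] to
    e_i combine to adding [vv b] to e_a. *)
Let comm_beta_gamma (a : 'I_i) b : [~ beta a, gamma b] = cT a (vv b).
Proof.
have [K1 E1] := unip_T (unip_beta a); have [K2 E2] := unip_T (unip_gamma b).
have [K3 E3] := unip_T (unip_delta a b).
have lea : a <= i by apply: ltnW.
have /dvdnP[k dk] : p %| co a (vv b) by apply: co_vv.
apply: (mulgI (gamma b * beta a)%g); rewrite -commgC.
rewrite /beta /gamma /cT -!cosetM ?groupM //; apply: cosetKP; rewrite ?groupM // => x.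
apply: eqZ_trans (T_mul2E (m := co i x + co a x) (unip_gamma b) (unip_beta a) _) _.
  by rewrite -modnDmr -modnMmr co_e_modp // modnMmr eqxx muln1 modnDmr.
apply: eqZ_sym; apply: eqZ_trans (T_mulE (m := co a x) (unip_delta a b) _) _.
  rewrite permM E1 co_modp // -modnDmr coMn_modp // -modnMmr co_e_modp //.
  rewrite (ltn_eqF (ltn_ord a)) mod0n muln0 mod0n addn0 E2 co_modp // -modnDmr coMn_modp // dk.
  by rewrite mulnA modnMl addn0.
rewrite mulrnDr addrA; apply: eqZD; last exact: eqZxx.
rewrite addrAC; apply: T_mul2E => //.
by rewrite dk mulnA -modnDmr modnMl addn0.
Qed.

Let c0 : 'I_p := Ordinal p_gt0.
Let D := ({ffun J -> 'I_p} * 'I_p)%type.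
Let ypar (dc : D) := yv dc.1 dc.2.

Let unip_yv d : unip i (yv d c0).
Proof. by split=> //; rewrite /dvdn co_yv mod0n. Qed.

Let unip_ypar (a : 'I_i) dc : unip a (ypar dc).
Proof. by apply: unip_lt => //; apply: yv_layer. Qed.

Let prodT (r : seq 'I_i) (y : 'I_i -> A) := (\prod_(a <- r) T a (y a))%g.

(** The factors do not interact modulo Z_(i+1), since each y a has its coordinates before i
    divisible by p. *)
Let prodTP r y : (forall a, y a \in layer i) ->
  prodT r y \in layer_ker i /\
  (forall x, eqZ (prodT r y x) (x + \sum_(a <- r) y a *+ co a x)%R).
Proof.
move=> Zy; have gy (a : 'I_i) : unip a (y a) by apply: unip_lt.
rewrite /prodT; elim: r => [|a r [IHK IHE]].
  by rewrite big_nil; split=> [|x]; rewrite ?group1 // perm1 big_nil addr0.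
have [KT TE] := unip_T (gy a).
rewrite big_cons; split=> [|x]; first exact: groupM.
rewrite permM TE big_cons addrA; apply: eqZ_trans (IHE _) _; apply: eqZD => //.
rewrite /eqZ -sumrB; apply: layer_sum => // b _; apply: eqZ_mul => //.
have leb : b <= i by apply: ltnW.
rewrite co_modp // -modnDmr coMn_modp // -modnMmr.
have : p %| co b (y a) by case/layerP: (Zy a) => /flagP h _; apply: h.
by move/eqP->; rewrite muln0 mod0n addn0.
Qed.

(** A normal form for elements of H: e_a, for a < i, moves by any class of Z_i / Z_(i+1), and e_i by
    a class with c = 0. Counting the parameters bounds |H| from below. *)
Let gP (Psi : {ffun 'I_i -> D} * {ffun J -> 'I_p}) :=
  (T i (yv Psi.2 c0) * prodT (index_enum _) (fun a => ypar (Psi.1 a)))%g.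

Let gPP Psi : gP Psi \in layer_ker i /\
  (forall x, eqZ (gP Psi x)
     (x + yv Psi.2 c0 *+ co i x + \sum_(a < i) ypar (Psi.1 a) *+ co a x)%R).
Proof.
have [K1 E1] := unip_T (unip_yv Psi.2).
have [K2 E2] := @prodTP (index_enum _) (fun a => ypar (Psi.1 a)) (fun a => yv_layer _ _).
split=> [|x]; first exact: groupM.
rewrite permM E1; apply: eqZ_trans (E2 _) _; apply: eqZD => //.
rewrite /eqZ -sumrB; apply: layer_sum => // a _; apply: eqZ_mul; first exact: yv_layer.
have lea : a <= i by apply: ltnW.
rewrite co_modp // -modnDmr coMn_modp // -modnMmr.
have : p %| co a (yv Psi.2 c0) by case/layerP: (yv_layer Psi.2 c0) => /flagP h _; apply: h.
by move/eqP->; rewrite muln0 mod0n addn0.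
Qed.

Let gP_lt Psi (a : 'I_i) : eqZ (gP Psi (e a)) (e a + ypar (Psi.1 a))%R.
Proof.
have [_ E] := gPP Psi; apply: eqZ_trans (E _) _.
rewrite (bigD1 a) //= addrA -[X in eqZ _ X]addr0; apply: eqZD; last first.
  rewrite /eqZ subr0; apply: layer_sum => // b nb; apply: layer_mul_dvdn; first exact: yv_layer.
  rewrite /dvdn co_e_modp 1?ltnW //.
  have -> : (val b == val a :> nat) = false by apply: negbTE.
  by rewrite mod0n.
rewrite -[X in eqZ _ (_ + X)%R]mulr1n; apply: eqZD; last first.
  apply: eqZ_mul; first exact: yv_layer.
  by rewrite co_e_modp ?eqxx 1?ltnW.
rewrite -[X in eqZ _ X]addr0; apply: eqZD => //; rewrite /eqZ subr0.
apply: layer_mul_dvdn; first exact: yv_layer.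
by rewrite /dvdn co_e_modp // (gtn_eqF (ltn_ord a)) mod0n.
Qed.

Let gP_i Psi : eqZ (gP Psi (e i)) (e i + yv Psi.2 c0)%R.
Proof.
have [_ E] := gPP Psi; apply: eqZ_trans (E _) _.
rewrite -[X in eqZ _ X]addr0; apply: eqZD; last first.
  rewrite /eqZ subr0; apply: layer_sum => // b nb; apply: layer_mul_dvdn; first exact: yv_layer.
  by rewrite /dvdn co_e_modp 1?ltnW // (ltn_eqF (ltn_ord b)) mod0n.
rewrite -[X in eqZ _ (_ + X)%R]mulr1n; apply: eqZD => //.
apply: eqZ_mul; first exact: yv_layer.
by rewrite co_e_modp ?eqxx.
Qed.

Let memH_sum a (I : Type) (r : seq I) (F : I -> A) :
  a <= i -> (forall j, unip a (F j) /\ cT a (F j) \in H) ->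
  unip a (\sum_(j <- r) F j)%R /\ cT a (\sum_(j <- r) F j)%R \in H.
Proof.
move=> le FH; elim/big_ind: _ => [|x y [gx Hx] [gy Hy]|//].
  have g0 := unip0 le; by split=> //; rewrite T_layer ?layer0 ?group1.
by split; [apply: unipD | rewrite T_add // groupM].
Qed.

Let memH_Mn a v k : unip a v -> cT a v \in H -> unip a (v *+ k) /\ cT a (v *+ k) \in H.
Proof. by move=> gv Hv; split; [apply: unipMn | rewrite -T_exp // groupX]. Qed.

Let Hbeta a : beta a \in H.
Proof. by rewrite mem_gen // inE imset_f. Qed.

Let Hgamma b : gamma b \in H.
Proof. by rewrite mem_gen // inE imset_f ?orbT. Qed.

Let Hdelta (a : 'I_i) b : cT a (vv b) \in H.
Proof. by rewrite -comm_beta_gamma groupR. Qed.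

Let H_ypar (a : 'I_i) dc : cT a (ypar dc) \in H.
Proof.
have [gs Hs] : unip a (\sum_b vv b *+ dc.1 b)%R /\ cT a (\sum_b vv b *+ dc.1 b)%R \in H.
  by apply: memH_sum => [|b]; [apply: ltnW | apply: memH_Mn].
have [ge He] := memH_Mn dc.2 (unip_beta a) (Hbeta a).
by rewrite /ypar /yv T_add // groupM.
Qed.

Let H_yv d : cT i (yv d c0) \in H.
Proof.
rewrite /yv mulr0n addr0.
have h b : unip i (vv b *+ d b) /\ cT i (vv b *+ d b) \in H.
  exact: memH_Mn (unip_gamma b) (Hgamma b).
by have [] := memH_sum (index_enum J) (leqnn i) h.
Qed.

Let H_gP Psi : coset K (gP Psi) \in H.
Proof.
have [K1 _] := unip_T (unip_yv Psi.2).
have Zy a : ypar (Psi.1 a) \in layer i by apply: yv_layer.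
have [K2 _] := prodTP (index_enum _) Zy.
rewrite cosetM // groupM //; first exact: H_yv.
rewrite /prodT; elim: (index_enum _) => [|a r IHr].
  by rewrite big_nil coset_id ?group1.
have [K3 _] := unip_T (unip_ypar a (Psi.1 a)).
have [K4 _] := prodTP r Zy.
by rewrite big_cons cosetM // groupM //; apply: H_ypar.
Qed.

Let card_Psi : #|{: {ffun 'I_i -> D} * {ffun J -> 'I_p}}| =
  p ^ (#|'I_i| + #|J| + #|'I_i| * #|J|).
Proof.
rewrite card_prod !card_ffun card_prod card_ffun !card_ord.
by rewrite -expnSr -expnM -expnD mulSn -addnA [#|J| * i + _]addnC addnA [#|J| * i]mulnC.
Qed.

Let card_H : p ^ (#|'I_i| + #|J| + #|'I_i| * #|J|) <= #|H|.
Proof.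
rewrite -card_Psi -(card_imset (f := fun Psi => coset K (gP Psi))).
  by apply/subset_leq_card/subsetP => _ /imsetP[Psi _ ->]; apply: H_gP.
move=> Psi Psi' /eqP ee.
have [K1 _] := gPP Psi; have [K2 _] := gPP Psi'.
have eZ := elimT (coset_layer_ker lt_in (KM K1) (KM K2)) ee.
case: Psi Psi' {ee K1 K2} eZ => [f1 d1] [f2 d2] /= eZ; congr (_, _).
  apply/ffunP => a.
  have := eqZ_trans (eqZ_sym (gP_lt (f1, d1) a)) (eqZ_trans (eZ _) (gP_lt (f2, d2) a)).
  move/eqZ_addl/yv_inj=> [].
  by case: (f1 a) (f2 a) => [? ?] [? ?] /= -> ->.
have := eqZ_trans (eqZ_sym (gP_i (f1, d1))) (eqZ_trans (eZ _) (gP_i (f2, d2))).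
by move/eqZ_addl/yv_inj=> [].
Qed.

Let coord y : D := odflt ([ffun=> c0], c0) [pick dc : D | eqZ y (ypar dc)].

Let coordP y : y \in layer i -> eqZ y (ypar (coord y)).
Proof.
move/layer_yv=> [dc ydc]; rewrite /coord; case: pickP => //= no.
by have := no dc; rewrite /ypar ydc.
Qed.

Let coords (g : {perm A}) : {ffun 'I_i -> D} * D :=
  ([ffun a : 'I_i => coord (g (e a) - e a)%R], coord (g (e i) - e i)%R).

(** Only e_0, ..., e_i matter: for a > i the vector e_a already lies in Z_(i+1), and so do its
    images. *)
Let coords_inj g h : g \in layer_ker i -> h \in layer_ker i ->
  coords g = coords h -> coset K g = coset K h.
Proof.
move=> Kg Kh [/ffunP egh egi]; apply: cosetKP => //.
have [Mg gZ] := mem_layer_ker _ le_in Kg; have [Mh hZ] := mem_layer_ker _ le_in Kh.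
apply: add_aut_eq_basis; rewrite ?flag_stab_add // => a lta.
have eC : coord (g (e a) - e a)%R = coord (h (e a) - e a)%R -> eqZ (g (e a)) (h (e a)).
  move=> ec; have := coordP (hZ (e a)); rewrite -ec => /eqZ_sym.
  move/(eqZ_trans (coordP (gZ (e a))))/eqZD/(_ (eqZxx (e a))).
  by rewrite !subrK.
case: (ltngtP a i) => [lt | gt | ->] in lta eC *; last exact: eC.
  by apply: eC; have := egh (Ordinal lt); rewrite !ffunE.
have Fe : e a \in flag i.+1 by apply: flag_e.
apply/layerP; split.
  by have [_ gF] := flag_stabP _ Mg; have [_ hF] := flag_stabP _ Mh; rewrite flagB ?gF ?hF.
have Gg := flag_stab_add Mg; have Gh := flag_stab_add Mh.
rewrite mulrnBl -!add_autMn //.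
have -> : e a *+ p ^ l i.+1 = 0%R.
  by rewrite -(subnKC (l_anti gt)) expnD mulrnA (pbasis_order Be) mul0rn.
by rewrite !add_aut0 // subrr.
Qed.

(** If c were -1 mod p, g would send e_i into F_(i+1). But its inverse preserves F_(i+1), which does
    not contain e_i. *)
Let coords_i g : g \in layer_ker i -> ~~ (p %| (coords g).2.2.+1).
Proof.
move=> Kg; have [Mg gZ] := mem_layer_ker _ le_in Kg.
have [Gg gF] := flag_stabP _ Mg.
apply/negP => dc; set y := (g (e i) - e i)%R.
have cy : co i y = (coord y).2 %[mod p].
  have /layerP[/flagP/(_ i (ltnSn i)) + _] := coordP (gZ (e i)).
  by rewrite coB_modp // co_yv => /eqP.
have Fg : g (e i) \in flag i.+1.
  apply/flagP => a; rewrite ltnS leq_eqVlt => /orP[/eqP -> | lt].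
    rewrite -(subrK (e i) (g (e i))) -/y /dvdn co_modp // -modnDml cy modnDml -modnDmr.
    by rewrite co_e_modp // eqxx modnDmr addn1.
  by have /flagP := gF i (e i) le_in (flag_e (leqnn i) le_in); apply.
have Mgv : g^-1%g \in flag_stab by rewrite groupV.
have [_ gvF] := flag_stabP _ Mgv.
have /flagP/(_ i (ltnSn i)) := gvF _ _ lt_in Fg.
by rewrite permK /dvdn co_e_modp // eqxx modn_small.
Qed.

(** By [coords_i] the last digit takes at most p - 1 values, so |Q| <= (p - 1) |H|, and an index
    below p is prime to p. *)
Let index_H : p^'.-nat #|Q : H|.
Proof.
pose S := [set Psi : {ffun 'I_i -> D} * D | ~~ (p %| Psi.2.2.+1)].
have card_S : #|S| <= p.-1 * p ^ (#|'I_i| + #|J| + #|'I_i| * #|J|).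
  pose F := [set c : 'I_p | ~~ (p %| c.+1)].
  have -> : S = setX [set: {ffun 'I_i -> D}] (setX [set: {ffun J -> 'I_p}] F).
    by apply/setP => -[f [d c]]; rewrite !inE.
  rewrite !cardsX !cardsT -card_Psi card_prod mulnA mulnC leq_mul //.
  have lt : p.-1 < p by rewrite prednK.
  rewrite -[X in _ <= X.-1](card_ord p) -(cardsC1 (Ordinal lt)).
  apply/subset_leq_card/subsetP => c; rewrite !inE; apply: contraNneq => ->.
  by rewrite /= prednK.
have reprQ q : q \in Q -> repr q \in layer_ker i.
  rewrite -{1}(coset_reprK q) => Qq.
  have nK : K <| layer_ker i.
    by apply: normalS (layer_ker_normal lt_in); [apply: layer_kerS | apply: layer_ker_sub].
  by rewrite -(quotientGK nK) mem_morphpre // repr_coset_norm.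
have card_Q : #|Q| <= #|S|.
  pose f (q : coset_of K) := coords (repr q).
  have injf : {in Q &, injective f}.
    move=> q q' Qq Qq' eqq; rewrite -[q]coset_reprK -[q']coset_reprK.
    by apply: coords_inj; rewrite ?reprQ.
  rewrite -(card_in_imset injf); apply/subset_leq_card/subsetP => _ /imsetP[q Qq ->].
  by rewrite inE coords_i ?reprQ.
have sHQ : H \subset Q.
  rewrite gen_subG subUset; apply/andP; split; apply/subsetP => _ /imsetP[a _ ->].
    by have [K1 _] := unip_T (unip_beta a); apply: mem_quotient.
  by have [K1 _] := unip_T (unip_gamma a); apply: mem_quotient.
rewrite p'natE //; apply/negP => /(dvdn_leq (indexg_gt0 _ _)); rewrite leqNgt => /negP[].
have H_gt0 : 0 < #|H| by apply: cardG_gt0.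
rewrite -(ltn_pmul2l H_gt0) Lagrange //.
apply: leq_ltn_trans card_Q _; apply: leq_ltn_trans card_S _.
apply: leq_ltn_trans (leq_mul (leqnn _) card_H) _.
by rewrite mulnC ltn_pmul2l ?prednK.
Qed.

Lemma layer_quotient_superperfect : p_superperfect p Q.
Proof.
have gQ a v : unip a v -> cT a v \in Q.
  by case/unip_T=> K1 _; apply: mem_quotient.
have zQ : coset K zz \in Q by apply: mem_quotient; case: zP.
apply: (@p_superperfect_heisenberg p _ Q _ _ beta gamma (coset K zz)) => //.
- by move=> a; apply/gQ/unip_beta.
- by move=> b; apply/gQ/unip_gamma.
- move=> a a'; apply: (T_commute (unip_beta a) (unip_beta a')).
    exact: co_beta.
  exact: co_beta.
- by move=> b b'; apply: (T_commute (unip_gamma b) (unip_gamma b')); apply: co_vv.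
- by move=> a; apply/T_expp/unip_beta.
- by move=> b; apply/T_expp/unip_gamma.
- move=> a b a'; rewrite comm_beta_gamma.
  apply: (T_commute (unip_delta a b) (unip_beta a')); first exact: co_beta.
  by apply: co_vv; apply: ltnW.
- move=> a b b'; rewrite comm_beta_gamma.
  by apply: (T_commute (unip_delta a b) (unip_gamma b')); apply: co_vv => //; apply: ltnW.
- move=> a; have [K1 E1] := unip_T (unip_beta a); have [Kz Ez] := zP.
  have [K2 _] := unip_T (unipMn 2 (unip_beta a)).
  have lea : a <= i by apply: ltnW.
  rewrite T_exp //; apply: (mulgI (coset K zz)); rewrite -conjgC.
  rewrite /beta /cT -!cosetM //; apply: cosetKP; rewrite ?groupM // => x.
  apply: eqZ_trans (mul_zE (m := co i x + co a x) _) _.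
    by rewrite E1 co_modp // -modnDmr coMn_modp // -modnMmr co_e_modp // modnMmr eqxx muln1 modnDmr.
  apply: eqZ_sym; apply: eqZ_trans (T_mulE (m := co a x) (unipMn 2 (unip_beta a)) _) _.
    rewrite Ez co_modp // -modnDmr coMn_modp // -modnMmr co_e_modp // (ltn_eqF (ltn_ord a)).
    by rewrite mod0n muln0 mod0n addn0.
  rewrite E1 Ez -mulrnA mulSn mul1n !mulrnDr !addrA; apply: eqZD => //.
  by rewrite addrAC.
- move=> b; have [K1 E1] := unip_T (unip_gamma b); have [Kz Ez] := zP.
  have [K2 E2] := unip_T (unipMn 2 (unip_gamma b)).
  have /dvdnP[k dk] : p %| co i (vv b) by apply: co_vv.
  (* Conjugating both sides by [zz] removes its inverse from the relation. *)
  rewrite T_exp //; apply: (conjg_inj (coset K zz)); rewrite conjgKV.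
  apply: (mulgI (coset K zz)); rewrite -conjgC.
  rewrite /gamma /cT -!cosetM //; apply: cosetKP; rewrite ?groupM // => x.
  apply: eqZ_sym; apply: eqZ_trans (mul_zE (m := co i x) _) _.
    rewrite E2 co_modp // -modnDmr coMn_modp // -modnMmr coMn_modp // dk.
    by rewrite mulnA modnMl muln0 mod0n addn0.
  apply: eqZ_sym; apply: eqZ_trans (T_mulE (m := co i x + co i x) (unip_gamma b) _) _.
    by rewrite Ez co_modp // -modnDmr coMn_modp // -modnMmr co_e_modp // modnMmr eqxx muln1 modnDmr.
  by rewrite E2 Ez mulr2n mulrnDl mulrnDr addrAC.
Qed.

End Step.

Lemma layer_ker_n : layer_ker n = 1%G.
Proof.
apply/val_inj/trivgP/subsetP => g /(mem_layer_ker _ (leqnn n))[_ gZ].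
rewrite inE; apply/eqP/permP => x; rewrite perm1; apply/eqP; rewrite -subr_eq0.
by have /layerP[_] := gZ x; rewrite l_n expn0 mulr1n => ->.
Qed.

Lemma layer_ker_0 : layer_ker 0 = flag_stab.
Proof.
apply/val_inj/eqP; rewrite eqEsubset layer_ker_sub //=.
apply/subsetP => g Mg; apply/mem_layer_ker => //; split=> // x.
apply/layerP; split; first exact/flagP.
apply/eqP/mulrn_eq0P => i _; apply/dvdn_mulr/dvdn_exp2l; exact: l_anti.
Qed.

(** Descending induction on i = n - j, from K_n = 1 to K_0 = [flag_stab]. *)
Lemma flag_stab_superperfect : p_superperfect p flag_stab.
Proof.
rewrite -layer_ker_0 -(subnn n).
suff h j : j <= n -> p_superperfect p (layer_ker (n - j)) by apply: h.
elim: j => [|j IHj] le; first by rewrite subn0 layer_ker_n; apply: superperfect1.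
have lt : n - j.+1 < n by rewrite ltn_subrL (leq_trans _ le).
have e1 : n - j = (n - j.+1).+1 by rewrite -subSn.
apply: (p_superperfect_ext _ _ (layer_quotient_superperfect lt)).
  by apply: normalS (layer_ker_normal lt); [apply: layer_kerS | apply/layer_ker_sub/ltnW].
by rewrite -e1; apply: IHj; apply: ltnW.
Qed.

(** * A Sylow p-subgroup: the automorphisms trivial on the factors of the flag *)

Definition flag_unip_set : {set {perm A}} :=
  [set g in flag_stab | [forall i : 'I_n, forall x in flag i, (g x - x)%R \in flag i.+1]].

Lemma flag_unipP g :
  reflect (g \in flag_stab /\
           forall i x, i < n -> x \in flag i -> (g x - x)%R \in flag i.+1)
          (g \in flag_unip_set).
Proof.
rewrite [g \in flag_unip_set]inE; apply: (iffP andP) => [[Mg /forallP h] | [Mg h]]; split=> //.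
  by move=> i x lt Fx; have /forall_inP/(_ _ Fx) := h (Ordinal lt).
by apply/forallP => i; apply/forall_inP => x; apply: h.
Qed.

Fact flag_unip_group_set : group_set flag_unip_set.
Proof.
apply/group_setP; split=> [|g h /flag_unipP[Mg gF] /flag_unipP[Mh hF]].
  by apply/flag_unipP; split=> [|i x lt _]; rewrite ?group1 // perm1 subrr flag0.
apply/flag_unipP; split=> [|i x lt Fx]; first exact: groupM.
rewrite permM -(subrK (g x) (h _)) -addrA flagD ?gF ?hF //.
by have [_ gM] := flag_stabP _ Mg; apply: gM => //; apply: ltnW.
Qed.
Canonical flag_unip := Group flag_unip_group_set.

(** Suppose g has prime order q <> p. The subgroups S c i = p ^ c F_i form a filtration that g - 1
    lowers. If g x = x + w with w in S c i, then g ^+ k x = x + w *+ k modulo S c i.+1, so w *+ q,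
    and hence w, lies in S c i.+1. Iterating gives g = 1. *)
Lemma flag_unip_pgroup : p.-group flag_unip.
Proof.
apply/pgroupP => q q_pr q_dvd; rewrite inE /=; apply/negPn/negP => nqp.
have [g Ug og] := Cauchy q_pr q_dvd.
have [Mg gF] := flag_unipP _ Ug; have [Gg gM] := flag_stabP _ Mg.
pose S c i := [pred x | [exists y in flag i, x == y *+ p ^ c]].
have SP c i x : reflect (exists2 y, y \in flag i & x = y *+ p ^ c) (x \in S c i).
  apply: (iffP existsP) => [[y /andP[Fy /eqP ->]] | [y Fy ->]]; first by exists y.
  by exists y; rewrite Fy eqxx.
have SD c i x y : i <= n -> x \in S c i -> y \in S c i -> (x + y)%R \in S c i.
  move=> le /SP[x' Fx ->] /SP[y' Fy ->]; apply/SP; exists (x' + y')%R; rewrite ?flagD //.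
  by rewrite mulrnDl.
have S0 c i : i <= n -> 0%R \in S c i.
  by move=> le; apply/SP; exists 0%R; rewrite ?flag0 // mul0rn.
have SMn c i x k : i <= n -> x \in S c i -> x *+ k \in S c i.
  by move=> le Sx; elim: k => [|k IHk]; rewrite ?S0 // mulrS SD.
have Sg c i x : i < n -> x \in S c i -> (g x - x)%R \in S c i.+1.
  move=> lt /SP[y Fy ->]; apply/SP; exists (g y - y)%R; first exact: gF.
  by rewrite add_autMn // mulrnBl.
have SS c i x : x \in S c i.+1 -> x \in S c i.
  by case/SP=> y Fy ->; apply/SP; exists y => //; apply: (subsetP (flagS (leqnSn i))).
have order_A (x : A) : x *+ p ^ l 0 = 0%R.
  by apply/eqP/mulrn_eq0P => i _; apply/dvdn_mulr/dvdn_exp2l; apply: l_anti.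
have step c i : i < n -> (forall x, (g x - x)%R \in S c i) -> forall x, (g x - x)%R \in S c i.+1.
  move=> lt gS x; move ew : (g x - x)%R => w.
  have main k : exists2 u, u \in S c i.+1 & ((g ^+ k)%g x = x + w *+ k + u)%R.
    elim: k => [|k [u Su IHk]]; first by exists 0%R; rewrite ?S0 // perm1 mulr0n !addr0.
    have Su' : u \in S c i := SS _ _ _ Su.
    have Sw : w \in S c i by rewrite -ew.
    exists ((g w - w) *+ k + ((g u - u) + u))%R.
      by apply: (SD _ _ _ _ lt); [apply: (SMn _ _ _ _ lt) | apply: (SD _ _ _ _ lt) => //]; apply: Sg.
    rewrite expgSr permM IHk !add_autD // add_autMn // subrK mulrnBl mulrS.
    rewrite -[g x](subrK x) ew [(w + x)%R]addrC -!addrA; congr (_ + (_ + _))%R.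
    by rewrite [RHS]addrCA addNKr.
  have [u Su] := main q.
  rewrite -og expg_order perm1 og -addrA -{1}[x]addr0 => /addrI/esym e1.
  (* The opposite of u is written as a natural multiple of u, so that [SMn] applies. *)
  have wq : w *+ q = (u *+ (p ^ l 0).-1)%R.
    apply: (addIr u); rewrite e1 -mulrSr prednK ?order_A //.
    by rewrite expn_gt0 p_gt0.
  have cop : coprime q (p ^ l 0).
    by rewrite coprimeXr // prime_coprime // dvdn_prime2.
  (* By Euler a positive power of q is 1 modulo p ^ l 0, so w is a multiple of w *+ q. *)
  rewrite -[w]mulr1n (mulrn_congr (order_A w) (esym (Euler_exp_totient cop))).
  rewrite -(prednK (_ : 0 < totient (p ^ l 0))) ?totient_gt0 ?expn_gt0 ?p_gt0 //.
  by rewrite expnS mulrnA wq !SMn.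
have all0 c : forall x, (g x - x)%R \in S c 0.
  elim: c => [|c IHc] x.
    by apply/SP; exists (g x - x)%R; [apply/flagP | rewrite expn0 mulr1n].
  have : forall i, i <= n -> forall x, (g x - x)%R \in S c i.
    by elim=> [|i IHi] lt //; apply: step => //; apply: IHi; apply: ltnW.
  (* As F_n = pA, the end of the filtration for c is its beginning for c + 1. *)
  move/(_ n (leqnn n) x)/SP=> [y /flagnP[z ->] ->].
  apply/SP; exists z; first exact/flagP.
  by rewrite expnS mulrnA.
have g1 : g = 1%g.
  apply/permP => x; rewrite perm1; apply/eqP; rewrite -subr_eq0.
  by have /SP[y _ ->] := all0 (l 0) x; rewrite order_A.
by move: og q_pr; rewrite g1 order1 => <-.
Qed.

Lemma transvection_e_unip a i : a < i -> i < n ->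
  transvection a (e i) \in flag_unip /\ (forall x, transvection a (e i) x = x + e i *+ co a x)%R.
Proof.
move=> lt ltn; have lta := ltn_trans lt ltn.
have [] := @layer_transvection a i (e i) (ltnW lt) ltn.
- exact: layer_e.
- rewrite prime_coprime // /dvdn -modnDmr -(expn1 p) co_e ?l_gt0 // expn1.
  by rewrite (ltn_eqF lt) mod0n addn0 modn_small.
move=> /(mem_layer_ker _ (ltnW ltn))[Mt _] tE; split=> //.
apply/flag_unipP; split=> // j x ltj Fx; rewrite tE addrC addKr.
case: (ltnP a j) => [ltaj | leja].
  by have /dvdnP[k ->] := flagP _ _ Fx a ltaj; rewrite mulrnA flag_mulp.
by rewrite flagMn // flag_e // (leq_ltn_trans leja).
Qed.

(** Descending induction on i. For x in F_i and a < i, let t be the transvection adding e_i to e_a.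
    The conjugate g * t * g^-1 is in [flag_unip], so it moves x by an element of F_(i+1). Applying g
    shows that e_i *+ co a (g x) is in F_(i+1), so p divides co a (g x). *)
Lemma norm_flag_unip : 'N_(add_aut A)(flag_unip) \subset flag_stab.
Proof.
apply/subsetP => g0 Ng0.
have main j : j <= n -> forall g, g \in 'N_(add_aut A)(flag_unip) ->
    forall x, x \in flag (n - j) -> g x \in flag (n - j).
  elim: j => [|j IHj] le g Ng x.
    rewrite subn0 => /flagnP[y ->]; case/setIP: Ng => Gg _.
    by rewrite add_autMn // flag_mulp.
  set i := n - j.+1 => Fx.
  have e1 : n - j = i.+1 by rewrite -subSn.
  have lti : i < n by rewrite ltn_subrL (leq_trans _ le).
  have [Gg NgU] := setIP Ng.
  apply/flagP => a lta.
  have [Ut tE] := transvection_e_unip lta lti.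
  have Ut' : (g * transvection a (e i) * g^-1)%g \in flag_unip.
    by rewrite -mulgA -[X in (X * _)%g]invgK -conjgE memJ_norm ?groupV.
  have [_ /(_ i x lti Fx) F1] := flag_unipP _ Ut'.
  have := IHj (ltnW le) g Ng _; rewrite e1 => /(_ _ F1).
  rewrite add_autB // -permM mulgKV permM tE addrC addKr.
  move/flagP/(_ i (ltnSn i)); rewrite -(expn1 p) /dvdn coMn ?l_gt0 // -modnMmr co_e ?l_gt0 //.
  by rewrite eqxx modnMmr muln1.
case/setIP: (Ng0) => Gg0 _; apply/flag_stabP; split=> // i x le Fx.
by rewrite -(subKn le); apply: main; rewrite ?leq_subr ?subKn.
Qed.

(** g acts on F_i / F_(i+1) as a scalar chi. If g has order p ^ N, then chi ^ (p ^ N) acts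
    trivially, and it is chi by Fermat. *)
Lemma flag_stab_p_elt g : g \in flag_stab -> p.-elt g -> g \in flag_unip.
Proof.
move=> Mg /p_natP[N oN]; have [Gg gM] := flag_stabP _ Mg.
apply/flag_unipP; split=> // i x lt Fx.
have le := ltnW lt.
pose chi := co i (g (e i)).
have main y : y \in flag i -> co i (g y) = chi * co i y %[mod p].
  move=> Fy; pose z := (y - e i *+ co i y)%R.
  have Fz : z \in flag i.+1.
    apply/flagP => a; rewrite ltnS leq_eqVlt => /orP[/eqP -> | lta].
      by rewrite /z (coB_modp lt) // (coMn_modp lt) // -modnMmr (co_e_modp lt) // modnMmr eqxx muln1.
    have Fz : z \in flag i by rewrite flagB // flagMn // flag_e.
    exact: (flagP _ _ Fz).
  have := flagP _ _ (gM _ _ lt Fz) i (ltnSn i).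
  by rewrite add_autB // add_autMn // (coB_modp lt) // (coMn_modp lt) // mulnC => /eqP.
have iter m : (g ^+ m)%g x \in flag i /\ co i ((g ^+ m)%g x) = chi ^ m * co i x %[mod p].
  elim: m => [|m [Fm IHm]]; first by rewrite expg0 perm1 expn0 mul1n.
  rewrite expgSr permM; split; first exact: gM.
  by rewrite main // -modnMmr IHm modnMmr mulnA expnS.
have chiN m : chi ^ (p ^ m) = chi %[mod p].
  elim: m => [|m IHm]; first by rewrite expn0 expn1.
  by rewrite expnSr expnM fermat_little.
have Fgx : (g x - x)%R \in flag i by rewrite flagB // gM.
apply/flagP => a; rewrite ltnS leq_eqVlt => /orP[/eqP -> | lta]; last exact: (flagP _ _ Fgx).
have [_] := iter (p ^ N); rewrite -oN expg_order perm1 oN -modnMml chiN modnMml => e1.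
by rewrite (coB_modp lt) // main // e1.
Qed.

Lemma index_flag_stab : p^'.-nat #|add_aut A : flag_stab|.
Proof.
have sMG : flag_stab \subset add_aut A by apply/subsetP => g /flag_stab_add.
have sUM : flag_unip \subset flag_stab by apply/subsetP => g /flag_unipP[].
(* If P were larger, its normalizer would contain a p-element of
   flag_stab outside flag_unip. *)
have [P sylP sUP] := Sylow_superset (subset_trans sUM sMG) flag_unip_pgroup.
have [sPG pP _] := and3P sylP.
have eUP : flag_unip :=: P.
  apply/eqP; rewrite eqEproper sUP /=; apply/negP => prUP.
  have /properP[_ [g /setIP[Pg Ng]]] := nilpotent_proper_norm (pgroup_nil pP) prUP.
  case/negP; apply: flag_stab_p_elt; last exact: mem_p_elt pP Pg.
  by apply: (subsetP norm_flag_unip); rewrite inE (subsetP sPG) ?Ng.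
have : p^'.-nat #|add_aut A : P| by case/and3P: sylP.
apply: pnat_dvd; apply: indexgS; rewrite -eUP; exact: sUM.
Qed.

Lemma add_aut_superperfect : p_superperfect p (add_aut A).
Proof.
apply: p_superperfect_index index_flag_stab flag_stab_superperfect.
by apply/subsetP => g /flag_stab_add.
Qed.

End Basis.

Local Open Scope ring_scope.

(** * Cocycles and extensions *)

Definition cocycle2 (gT : finGroupType) (M : zmodType) (f : gT -> gT -> M) : Prop :=
  forall x y z, f y z - f (x * y)%g z + f x (y * z)%g - f x y = 0.

Definition coboundary2 (gT : finGroupType) (M : zmodType) (f : gT -> gT -> M) : Prop :=
  exists t : gT -> M, forall x y, f x y = t y - t (x * y)%g + t x.

Section Cochains.

Variables (gT : finGroupType) (M : finZmodType).
Let act := trivial_gmodule gT M.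

Definition tup1 (x : gT) : {ffun 'I_1 -> gT} := [ffun=> x].
Definition tup2 (x y : gT) : {ffun 'I_2 -> gT} := [ffun i => if i == ord0 then x else y].
Definition tup3 (x y z : gT) : {ffun 'I_3 -> gT} :=
  [ffun i => if i == ord0 then x else if i == ord_max then z else y].

Lemma tup2E (g : {ffun 'I_2 -> gT}) : g = tup2 (g ord0) (g ord_max).
Proof.
apply/ffunP => i; rewrite ffunE; case: eqP => [-> // | /eqP i0]; congr (g _).
by apply/val_inj; case: i i0 => [[|[]]].
Qed.

Lemma tup1E (g : {ffun 'I_1 -> gT}) : g = tup1 (g ord0).
Proof. by apply/ffunP => i; rewrite ffunE ord1. Qed.

Lemma coboundary1E (t : cochain gT M 1) x y :
  coboundary act t (tup2 x y) = t (tup1 y) - t (tup1 (x * y)%g) + t (tup1 x).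
Proof.
rewrite /coboundary ffunE big_ord_recl big_ord0 /= addr0 expr1 sqrrN expr1n.
rewrite !mulrNz !mulr1z; congr (t _ - t _ + t _); rewrite [LHS]tup1E; congr tup1;
  by rewrite !ffunE //=.
Qed.

Lemma tup3E (g : {ffun 'I_3 -> gT}) : exists x y z, g = tup3 x y z.
Proof.
exists (g ord0), (g (Ordinal (isT : 1 < 3)%N)), (g ord_max).
apply/ffunP => i; rewrite ffunE.
case: eqP => [-> // | /eqP i0]; case: eqP => [-> // | /eqP i2]; congr (g _).
by apply/val_inj; case: i i0 i2 => [[|[|[]]]].
Qed.

Lemma coboundary2E (f : cochain gT M 2) x y z :
  coboundary act f (tup3 x y z) =
  f (tup2 y z) - f (tup2 (x * y)%g z) + f (tup2 x (y * z)%g) - f (tup2 x y).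
Proof.
rewrite /coboundary ffunE !big_ord_recl big_ord0 /= addr0 expr1 sqrrN expr1n.
rewrite (_ : (-1 : int) ^+ 3 = -1) // !mulrNz !mulr1z addrA.
congr (f _ - f _ + f _ - f _); rewrite [LHS]tup2E; congr tup2; by rewrite !ffunE //=.
Qed.

(** Passes from the quotient of finite groups of cochains to functions of two variables. *)
Lemma cohomology2_eq1P :
  cohomology act 2 = 1%G <->
  forall f : gT -> gT -> M, cocycle2 f -> coboundary2 f.
Proof.
have cohE : cohomology act 2 = 1%G <-> cocycles act 2 \subset coboundaries act 2.
  have nB : cocycles act 2 \subset 'N(coboundaries act 2).
    apply: subset_trans (cent_sub _); apply/centsP => f _ h _.
    exact: (addrC f h).
  rewrite -(quotient_sub1 nB); split=> [e1 | /trivgP h]; last exact: val_inj.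
  by have := subxx (cohomology act 2); rewrite {2}e1.
apply: iff_trans cohE _; split=> [sub f cf | h].
  pose F : cochain gT M 2 := [ffun g : {ffun 'I_2 -> gT} => f (g ord0) (g ord_max)].
  have FE x y : F (tup2 x y) = f x y by rewrite !ffunE.
  have ZF : F \in cocycles act 2.
    apply/kerP => //; apply/ffunP => g; have [x [y [z ->]]] := tup3E g.
    rewrite [LHS]coboundary2E !FE ffunE; exact: cf.
  have /morphimP[t _ _ Ft] := subsetP sub _ ZF.
  exists (fun x => t (tup1 x)) => x y.
  by rewrite -FE Ft [LHS]coboundary1E.
apply/subsetP => F /kerP; rewrite inE => /(_ isT) F0.
have [|t tE] := h (fun x y => F (tup2 x y)).
  move=> x y z; rewrite -coboundary2E.
  by move/ffunP: F0 => /(_ (tup3 x y z)); rewrite [RHS]ffunE.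
apply/morphimP; exists [ffun g : {ffun 'I_1 -> gT} => t (g ord0)]; rewrite ?inE //.
apply/ffunP => g; rewrite [g]tup2E [RHS]coboundary1E tE.
by rewrite !ffunE.
Qed.

End Cochains.

(** Cocycles are not normalized. This evaluation and the next give the unit of the extension and the
    centrality of M in it. *)
Lemma cocycle2_1l (gT : finGroupType) (M : zmodType) (f : gT -> gT -> M) x :
  cocycle2 f -> f 1%g x = f 1%g 1%g.
Proof.
move=> fc; have := fc 1%g 1%g x; rewrite !mul1g subrr add0r => /eqP.
by rewrite subr_eq0 => /eqP.
Qed.

Lemma cocycle2_1r (gT : finGroupType) (M : zmodType) (f : gT -> gT -> M) x :
  cocycle2 f -> f x 1%g = f 1%g 1%g.
Proof.
move=> fc; have := fc x 1%g 1%g; rewrite !mulg1 subrK => /eqP.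
by rewrite subr_eq0 => /eqP.
Qed.

Section Extension.

Variables (gT : finGroupType) (M : finZmodType) (f : gT -> gT -> M).
Hypothesis f_cocycle : cocycle2 f.

(** The cocycle proof is a parameter of the type, so that the group structure can be an instance on
    it. *)
Definition cocycle_ext of cocycle2 f : Type := (M * gT)%type.
Local Notation ext := (cocycle_ext f_cocycle).
HB.instance Definition _ := Finite.copy ext (M * gT)%type.

Implicit Types u v : ext.
Definition ext_one : ext := (- f 1%g 1%g, 1%g).
Definition ext_mul u v : ext := (u.1 + v.1 + f u.2 v.2, (u.2 * v.2)%g).
Definition ext_inv u : ext :=
  (- u.1 - f u.2^-1%g u.2 - f 1%g 1%g, u.2^-1%g).

Fact ext_mulA : associative ext_mul.
Proof.
move=> [a x] [b y] [c z]; rewrite /ext_mul /= mulgA; congr (_, _).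
have /eqP := f_cocycle x y z; rewrite subr_eq0 addrAC subr_eq => /eqP e1.
by rewrite (addrAC (a + b)) -(addrA (a + b + c)) -e1 !addrA.
Qed.

Fact ext_mul1 : left_id ext_one ext_mul.
Proof.
by move=> [a x]; rewrite /ext_mul /= mul1g (cocycle2_1l _ f_cocycle) addrAC addNr add0r.
Qed.

Fact ext_mulV : left_inverse ext_one ext_inv ext_mul.
Proof.
move=> [a x]; rewrite /ext_mul /ext_inv /ext_one /= mulVg; congr (_, _).
by rewrite -opprD -addrA addrAC addNr add0r.
Qed.

HB.instance Definition _ :=
  Finite_isGroup.Build ext ext_mulA ext_mul1 ext_mulV.

End Extension.

(** The extension defined by f splits, and a complement of M meets each fibre over gT in one point.
    This gives a multiplicative section. *)
Lemma superperfect_coboundary2 (p : nat) (gT hT : finGroupType) (M : finZmodType)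
    (G : {group hT}) (h : {morphism [set: gT] >-> hT}) (f : gT -> gT -> M) :
  p.-nat #|M| -> p_superperfect p G -> 'injm h -> h @* [set: gT] = G ->
  cocycle2 f -> coboundary2 f.
Proof.
move=> pM [_ splitG] injh hG f_c.
pose E := cocycle_ext f_c.
pose pi (u : E) := h u.2.
have piM : {in [set: E] &, {morph pi : u v / (u * v)%g}}.
  by move=> u v _ _; rewrite /pi /= morphM ?inE.
pose q := Morphism piM.
have kerP1 (u : E) : (u \in 'ker q) = (u.2 == 1%g).
  rewrite !inE /= /pi -(morph1 h); apply/eqP/eqP => [|-> //].
  by apply: (injmP injh); rewrite inE.
have pK : p.-group ('ker q).
  have -> : 'ker q = [set ((a, 1%g) : E) | a : M].
    apply/setP => -[a x]; rewrite kerP1 /=.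
    by apply/eqP/imsetP => [-> | [b _ [_ ->]]] //; exists a.
  by rewrite /pgroup card_imset ?cardsT // => a b [].
have qE' : q @* [set: E] = G.
  rewrite -hG; apply/setP => y; apply/morphimP/morphimP => -[u _ _ ->].
    by exists u.2; rewrite ?inE.
  by exists (0, u); rewrite ?inE.
have Ec : 'ker q \subset 'Z([set: E]).
  apply/subsetP => -[a x]; rewrite kerP1 => /eqP /= ->; apply/centerP.
  split=> [|[b y] _]; first exact: in_setT.
  rewrite /commute; congr (_, _) => /=; last by rewrite mulg1 mul1g.
  by rewrite (cocycle2_1l _ f_c) (cocycle2_1r _ f_c) [a + b]addrC.
have /splitsP[L /complP[tiL defE]] := splitG _ _ q qE' Ec pK.
have lift x : exists a, ((a, x) : E) \in L.
  have : ((0, x) : E) \in ('ker q * L)%g by rewrite defE inE.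
  case/mulsgP=> -[a y] [b z]; rewrite kerP1 => /eqP /= -> Lb [_ ->].
  by exists b; rewrite mul1g.
have uniqL x a b : ((a, x) : E) \in L -> ((b, x) : E) \in L -> a = b.
  move=> La Lb; apply/eqP.
  have : (((a, x) : E) * ((b, x) : E)^-1)%g \in 'ker q :&: L.
    by apply/setIP; split; [rewrite kerP1 /= mulgV | rewrite groupM ?groupV].
  rewrite tiL => /set1P/(canRL (mulgKV _)); rewrite mul1g => -[->].
  exact: eqxx.
have [t tL] : exists t : gT -> M, forall x, ((t x, x) : E) \in L.
  exact: fin_all_exists lift.
(* Multiplicativity reads t (x * y) = t x + t y + f x y, hence the sign. *)
exists (fun x => - t x) => x y.
have := uniqL _ _ _ (tL (x * y)%g) (groupM (tL x) (tL y)) => /= ->.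
have E3 (V : zmodType) (a b c : V) : c = - b - - (a + b + c) - a.
  by rewrite opprK (addrC a) -(addrA b) addKr addrAC subrr add0r.
exact: E3.
Qed.

(** * Characters obstructing the vanishing *)

(** A Bockstein argument: e carries integral cocycles into M, and c brings the bounding cochains
    back to F_p, so chi lifts to characters mod every p ^ r. A value prime to p at g0 forces p ^ r
    to divide the order of g0. *)
Lemma no_character_of_coboundary2 (p : nat) (gT : finGroupType) (M : finZmodType)
    (c : M -> 'F_p) (e : M) (chi : gT -> int) (g0 : gT) :
  prime p -> {morph c : x y / x + y} -> c e = 1 ->
  (forall x y, (p %| chi x + chi y - chi (x * y)%g)%Z) -> ~~ (p %| chi g0)%Z ->
  ~ (forall f : gT -> gT -> M, cocycle2 f -> coboundary2 f).
Proof.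
move=> p_pr cD ce chiM chi0 split.
have c0 : c 0 = 0 by apply: (addrI (c 0)); rewrite -cD !addr0.
have cN x : c (- x) = - c x by apply: (addrI (c x)); rewrite -cD !subrr c0.
have cMn x n : c (x *+ n) = c x *+ n.
  by elim: n => [|n IHn]; rewrite ?mulr0n ?c0 // !mulrS cD IHn.
have cMz x n : c (x *~ n) = c x *~ n.
  by case: n => n; [apply: cMn | rewrite !NegzE !mulrNz cN; congr (- _); apply: cMn].
have dvdF (m : int) : (p %| m)%Z = (m%:~R == 0 :> 'F_p) := dvdz_pcharf (pchar_Fp p_pr) m.
pose P r := exists2 phi : gT -> int,
  forall x y, ((p ^ r)%N %| phi x + phi y - phi (x * y)%g)%Z & ~~ (p %| phi g0)%Z.
(* The carries of chi mod p ^ r.+1 form a cocycle; a cochain bounding it corrects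
   chi to a character mod p ^ r.+2. *)
have PS r : P r.+1 -> P r.+2.
  case=> phi phiM phi0.
  pose k x y := ((phi x + phi y - phi (x * y)%g) %/ (p ^ r.+1)%N)%Z.
  have kE x y : k x y * (p ^ r.+1)%N%:Z = phi x + phi y - phi (x * y)%g by apply: divzK.
  have pr0 : (p ^ r.+1)%N%:Z != 0 by rewrite -lt0n expn_gt0 prime_gt0.
  have [|t tE] := split (fun x y => e *~ k x y).
    move=> x y z; rewrite -!mulrzBr -mulrzDr -mulrzBr.
    suff -> : k y z - k (x * y)%g z + k x (y * z)%g - k x y = 0 by rewrite mulr0z.
    apply: (mulIf pr0); rewrite mul0r !(mulrDl, mulNr) !kE mulgA.
    ring.
  pose T x : int := (c (t x) : nat).
  have TE x : (T x)%:~R = c (t x) by rewrite /T -pmulrn natr_Zp.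
  exists (fun x => phi x - (p ^ r.+1)%N%:Z * T x); last first.
    by rewrite rpredBr // dvdz_mulr // dvdzE /= expnS dvdn_mulr.
  move=> x y.
  have -> : phi x - (p ^ r.+1)%N%:Z * T x + (phi y - (p ^ r.+1)%N%:Z * T y) -
    (phi (x * y)%g - (p ^ r.+1)%N%:Z * T (x * y)%g) =
    (p ^ r.+1)%N%:Z * (k x y - (T y - T (x * y)%g + T x)).
    by rewrite mulrBr [_ * k x y]mulrC kE; ring.
  rewrite (expnSr p r.+1) PoszM; apply: dvdz_mul => //; rewrite dvdF !(rmorphB, rmorphD) /= !TE.
  have := congr1 c (tE x y); rewrite cMz ce !cD cN => ->.
  by rewrite subrr.
have P1 : P 1%N by exists chi => // x y; rewrite expn1.
have Pall r : P r.+1 by elim: r => // r; apply: PS.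
(* With this exponent the modulus exceeds |gT|, hence the order of g0. *)
have [phi phiM phi0] := Pall #|gT|.
set N := (p ^ #|gT|.+1)%N in phiM.
have phi1 : (N %| phi 1%g)%Z.
  by have := phiM 1%g 1%g; rewrite mulg1 addrK.
have phiX n : (N %| phi (g0 ^+ n)%g - phi g0 * n%:Z)%Z.
  elim: n => [|n IHn]; first by rewrite expg0 mulr0 subr0.
  have -> : phi (g0 ^+ n.+1)%g - phi g0 * n.+1%:Z =
     (phi (g0 ^+ n)%g - phi g0 * n%:Z) - (phi g0 + phi (g0 ^+ n)%g - phi (g0 * g0 ^+ n)%g).
    by rewrite expgS intS; ring.
  exact: rpredB.
have := phiX #[g0]; rewrite expg_order rpredBl // => dv.
have cop : coprimez N (phi g0).
  by rewrite coprimezE /= coprimeXl // prime_coprime.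
move: dv; rewrite Gauss_dvdzr // => /dvdn_leq /=.
rewrite order_gt0 => /(_ isT); rewrite leqNgt => /negP[].
apply: leq_ltn_trans (max_card _) _.
exact: leq_ltn_trans (leqnSn _) (ltn_expl _ (prime_gt1 p_pr)).
Qed.

(** delta represents a character into the units of Z / p ^ 2. Raising to the power p - 1 lands in
    the subgroup 1 + pZ / p ^ 2, isomorphic to Z / p. *)
Lemma no_nat_character_of_coboundary2 (p : nat) (gT : finGroupType) (M : finZmodType)
    (c : M -> 'F_p) (e : M) (delta : gT -> nat) (g0 : gT) :
  prime p -> {morph c : x y / x + y} -> c e = 1 ->
  (forall x y, delta (x * y)%g = delta x * delta y %[mod p ^ 2])%N ->
  (delta 1%g = 1 %[mod p ^ 2])%N -> (delta g0 = 1 + p %[mod p ^ 2])%N ->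
  ~ (forall f : gT -> gT -> M, cocycle2 f -> coboundary2 f).
Proof.
move=> p_pr cD ce dM d1 d0.
have p_gt0 := prime_gt0 p_pr; have p_gt1 := prime_gt1 p_pr.
have p2_gt0 : (0 < p ^ 2)%N by rewrite expn_gt0 p_gt0.
have copd x : coprime p (delta x).
  rewrite prime_coprime //; apply/negP => dx.
  have := dM x x^-1%g; rewrite mulgV d1 => /(congr1 (fun m => m %% p))%N.
  rewrite !modn_dvdm ?dvdn_exp // (eqP (dvdn_mulr _ dx)) modn_small //.
(* The Fermat quotient (delta x ^ (p - 1) - 1) / p is additive mod p. *)
pose a x := (delta x ^ p.-1 %% p ^ 2)%N; pose m x := (a x %/ p)%N.
have aE x : a x = (m x * p + 1)%N.
  rewrite {1}(divn_eq (a x) p); congr (_ + _)%N.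
  rewrite modn_dvdm ?dvdn_exp //.
  have := Euler_exp_totient (_ : coprime (delta x) p); rewrite totient_prime // coprime_sym.
  by move=> /(_ (copd x)); rewrite [RHS]modn_small.
apply: (@no_character_of_coboundary2 p gT M c e (fun x => (m x)%:Z) g0) => //.
  move=> x y; rewrite -PoszD -eqz_mod_dvd !modz_nat eqz_nat.
  rewrite -(eqn_pmul2r p_gt0) !muln_modl -(eqn_modDr 1 _ (m (x * y)%g * p)) -aE.
  rewrite /a -[(p * p)%N]/(p ^ 2)%N modn_mod -modnXm dM modnXm expnMn.
  rewrite -modnMm -/(a x) -/(a y) !aE.
  rewrite (_ : ((m x * p + 1) * (m y * p + 1))%N = m x * m y * p ^ 2 + ((m x + m y) * p + 1))%N ?modnMDl //.
  by rewrite -mulnn; ring.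
(* Consequently the Fermat quotient at g0 is p - 1, nonzero mod p. *)
have binom k : ((1 + p) ^ k = 1 + k * p %[mod p ^ 2])%N.
  elim: k => [|k IHk]; first by rewrite mul0n addn0.
  rewrite expnS -modnMmr IHk modnMmr.
  rewrite (_ : ((1 + p) * (1 + k * p))%N = k * p ^ 2 + (1 + k.+1 * p))%N ?modnMDl //.
  by rewrite -mulnn mulSn; ring.
have : a g0 = (1 + p.-1 * p)%N.
  rewrite /a -modnXm d0 modnXm binom modn_small //.
  by rewrite -mulnn -{3}(prednK p_gt0) mulSn ltn_add2r.
rewrite aE addnC => /addnI/eqP; rewrite eqn_pmul2r // => /eqP ->.
rewrite dvdzE /= gtnNdvd //; first by rewrite -subn1 subn_gt0.
by rewrite prednK.
Qed.

(** * The determinant character across a gap of at least two *)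

Section Gap.

Variables (A : finZmodType) (p n : nat) (l : nat -> nat).
Variables (e : nat -> A) (co : nat -> A -> nat).
Hypotheses (p_pr : prime p) (Be : pbasis p n l e co).
Variables (m v : nat).
Hypotheses (m_gt0 : (0 < m)%N) (le_mn : (m <= n)%N) (v_ge2 : (2 <= v)%N).
Hypothesis l_ge : forall a, (a < m)%N -> (v <= l a)%N.
Hypothesis l_le : forall a, (m <= a)%N -> (l a + 2 <= v)%N.

Let p_gt0 := prime_gt0 p_pr.
Let p_gt1 := prime_gt1 p_pr.
Let p2_gt1 : (1 < p ^ 2)%N. Proof. by rewrite -{1}(exp1n 2) ltn_exp2r. Qed.

Let l_ge2 a : (a < m)%N -> (2 <= l a)%N.
Proof. by move/l_ge; apply: leq_trans. Qed.

Let R := 'Z_(p ^ 2).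

Let natR (x y : nat) : (x = y %[mod p ^ 2])%N -> x%:R = y%:R :> R.
Proof. by move=> xy; apply: val_inj; rewrite /= !val_Zp_nat. Qed.

Let coR (a : 'I_m) x : R := (co a x)%:R.

Let coRD a x y : coR a (x + y) = coR a x + coR a y.
Proof. by rewrite /coR -natrD; apply: natR; apply: (co_mod Be); apply: l_ge2. Qed.

Let coR0 a : coR a 0 = 0.
Proof. by apply: (addrI (coR a 0)); rewrite -coRD !addr0. Qed.

Let coRMn a x k : coR a (x *+ k) = coR a x *+ k.
Proof.
by elim: k => [|k IHk]; rewrite ?mulr0n ?coR0 // !mulrS coRD IHk.
Qed.

Let coR_e (a b : 'I_m) : coR a (e b) = (a == b)%:R.
Proof. by apply: natR; rewrite (co_e Be) ?l_ge2. Qed.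

(* p ^ (l a - l b), hence p ^ 2, divides the coordinate of a p ^ l b-torsion element. *)
Let coR_tors a b x : (m <= b)%N -> x *+ (p ^ l b) = 0 -> coR a x = 0.
Proof.
move=> le x0; apply: (@natR _ 0); apply/eqP; rewrite mod0n -/(dvdn _ _).
have ltan : (a < n)%N by apply: leq_trans le_mn.
have := elimT (mulrn_eq0P Be _ _) (introT eqP x0) a ltan.
have le2 : (l b + 2 <= l a)%N by apply: leq_trans (l_le le) (l_ge _).
move/(dvdn_trans (dvdn_exp2l p le2)).
by rewrite expnD dvdn_pmul2l // expn_gt0 p_gt0.
Qed.

(** The matrix of g on p ^ (v - 2) A / p ^ v A, a free Z / p ^ 2-module on the classes of p ^ (v -
    2) e_a for a < m. *)
Definition coord_matrix (g : {perm A}) : 'M['Z_(p ^ 2)]_m :=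
  \matrix_(a, b) (co a (g (e b)))%:R.

(** Basis vectors of index at least m drop out by [coR_tors]. The order is reversed because
    permutations compose from left to right. *)
Lemma coord_matrixM g h : g \in add_aut A -> h \in add_aut A ->
  coord_matrix (g * h)%g = coord_matrix h *m coord_matrix g.
Proof.
move=> Gg Gh; apply/matrixP => a b; rewrite !mxE permM.
rewrite [g (e b)](pbasis_gen Be) add_aut_sum // -[LHS]/(coR a _).
rewrite (big_morph (coR a) (coRD a) (coR0 a)).
pose F i := coR a (h (e i)) *+ co i (g (e b)).
transitivity (\sum_(i < n) F i); first by apply: eq_bigr => i _; rewrite add_autMn // coRMn.
transitivity (\sum_(i < m) F i); last first.
  by apply: eq_bigr => i _; rewrite !mxE /F mulr_natr.
rewrite (big_ord_widen _ F le_mn) [RHS]big_mkcond; apply: eq_bigr => i _.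
case: ltnP => // le; rewrite /F (coR_tors _ le) ?mul0rn //.
by rewrite -add_autMn // (pbasis_order Be) add_aut0.
Qed.

Lemma coord_matrix1 : coord_matrix 1%g = 1%:M.
Proof. by apply/matrixP => a b; rewrite !mxE perm1 -[LHS]/(coR a _) coR_e. Qed.

Lemma exists_det_gap : exists2 g, g \in add_aut A & \det (coord_matrix g) = 1 + p%:R.
Proof.
pose i0 : 'I_m := Ordinal m_gt0.
have v0 : (e 0%N *+ p) *+ (p ^ l 0%N) = 0.
  by rewrite -mulrnA mulnC mulrnA (pbasis_order Be) mul0rn.
have cop : coprime p (1 + co 0%N (e 0%N *+ p)).
  rewrite prime_coprime // /dvdn -modnDmr.
  have := coMn Be (e 0%N) p (ltnW (l_ge2 m_gt0)); rewrite expn1 => ->.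
  by rewrite modnMr addn0 modn_small.
have [Gt tE] := transvectionP Be (leq_trans m_gt0 le_mn) v0 cop.
exists (transvection co 0%N (e 0%N *+ p)) => //.
(* This transvection multiplies e_0 by 1 + p and fixes the other basis vectors. *)
have -> : coord_matrix (transvection co 0%N (e 0%N *+ p)) =
    diag_mx (\row_a (1 + (a == i0)%:R * p%:R)).
  apply/matrixP => a b; rewrite !mxE tE -[LHS]/(coR a _) coRD coRMn coRMn coR_e.
  have -> : coR a (e 0%N) = (a == i0)%:R := coR_e a i0.
  rewrite -[_ *+ co _ _]mulr_natr -[(co _ _)%:R]/(coR i0 (e b)) coR_e.
  rewrite -[_ *+ p]mulr_natr; case: (eqVneq a b) => [-> | nab].
    rewrite [i0 == b]eq_sym mulr1n; congr (_ + _).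
    by case: eqP; rewrite ?mulr1 ?mul0r.
  rewrite mulr0n add0r; case: (eqVneq a i0) => [a0 | _]; last by rewrite !mul0r.
  by rewrite -a0 (negbTE nab) mulr0.
rewrite det_diag (bigD1 i0) //= big1 ?mulr1 => [|a na]; rewrite mxE ?eqxx ?mul1r //.
by rewrite (negbTE na) mul0r addr0.
Qed.

Lemma gap_not_coboundary2 (gT : finGroupType) (h : {morphism [set: gT] >-> {perm A}}) :
  h @* [set: gT] = add_aut A ->
  ~ (forall f : gT -> gT -> A, cocycle2 f -> coboundary2 f).
Proof.
move=> hG.
have Gh x : h x \in add_aut A by rewrite -hG mem_morphim ?inE.
have [g Gg dg] := exists_det_gap.
have [x0 hx0] : exists x, g = h x.
  by move: Gg; rewrite -hG => /morphimP[x _ _ ->]; exists x.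
pose delta x := (\det (coord_matrix (h x)) : nat).
have natE (y z : R) : y = z -> (y = z %[mod p ^ 2])%N by move=> ->.
have valE k : (k = (k%:R : R) %[mod p ^ 2])%N by rewrite val_Zp_nat // modn_mod.
pose i0 : 'I_m := Ordinal m_gt0.
apply: (@no_nat_character_of_coboundary2 p gT A (fun x => (co 0%N x)%:R) (e 0%N) delta x0) => //.
- move=> x y /=; rewrite -natrD; apply/val_inj; rewrite /= !val_Fp_nat //.
  rewrite -(expn1 p); apply: (co_mod Be); exact: ltnW (l_ge2 m_gt0).
- apply: (@val_inj _ _ _ _ (1 : 'F_p)); rewrite /= val_Fp_nat //.
  have := co_e Be 0 (ltnW (l_ge2 m_gt0)); rewrite expn1 => ->.
  by rewrite eqxx modn_small.
- move=> x y; rewrite /delta morphM ?inE // coord_matrixM // det_mulmx.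
  by rewrite [RHS]valE natrM !natr_Zp mulrC.
- by rewrite /delta morph1 coord_matrix1 det1 [RHS]valE.
- by rewrite /delta -hx0 dg [RHS]valE natrD.
Qed.

End Gap.

(** * The standard basis *)

Lemma Zp_addn_mod q (u v : 'Z_q) : (1 < q)%N -> ((u + v)%R = u + v %[mod q])%N.
Proof. by move=> q1; rewrite /= {3}Zp_cast // modn_mod. Qed.

Section StandardBasis.

Variables (p k : nat) (lambda rho : k.-tuple nat).
Hypothesis p_pr : prime p.
Hypothesis lambda_gt0 : forall i : 'I_k, (0 < tnth lambda i)%N.

Local Notation A := (abelian_pgroup p lambda rho).

Lemma abpD (x y : A) i : (x + y) i = x i + y i. Proof. exact: ffunE. Qed.
Lemma abp0 i : (0 : A) i = 0. Proof. exact: ffunE. Qed.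
Lemma abpMn (x : A) m i : (x *+ m) i = x i *+ m.
Proof. by elim: m => [|m IHm]; rewrite ?mulr0n ?abp0 // !mulrS abpD IHm. Qed.
Lemma abp_sum (I : Type) (r : seq I) (F : I -> A) i :
  (\sum_(t <- r) F t) i = \sum_(t <- r) F t i.
Proof. by apply: (big_morph (fun x : A => x i)) => [x y|]; rewrite ?abpD ?abp0. Qed.

Definition abp_index : finType := {i : 'I_k & 'I_(tnth rho i)}.
Definition index_exp (t : abp_index) : nat := tnth lambda (tag t).
Definition std_vec (t : abp_index) : A :=
  [ffun i => \row_j (Tagged (fun i => 'I_(tnth rho i)) j == t)%:R].
Definition std_coord (t : abp_index) (x : A) : nat := x (tag t) 0 (tagged t).

Let q_gt1 i : (1 < p ^ tnth lambda i)%N.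
Proof. by rewrite -(exp1n (tnth lambda i)) ltn_exp2r ?prime_gt1. Qed.

Lemma std_coordD t x y :
  (std_coord t (x + y)%R = std_coord t x + std_coord t y %[mod p ^ index_exp t])%N.
Proof. by rewrite /std_coord abpD mxE; apply: Zp_addn_mod. Qed.

Lemma std_coord_vec t u : (std_coord t (std_vec u) = (t == u) %[mod p ^ index_exp t])%N.
Proof.
rewrite /std_coord ffunE mxE; case: t => i j /=.
by rewrite val_Zp_nat // modn_mod.
Qed.

Lemma std_vec_order t : std_vec t *+ (p ^ index_exp t) = 0.
Proof.
apply/ffunP => i; rewrite abpMn abp0; apply/rowP => j; rewrite ffunE.
rewrite mulmxnE !mxE.
case: eqP => [<- | _]; last by rewrite mul0rn.
by rewrite mulr1n; apply: pchar_Zp.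
Qed.

Lemma std_vec_gen (x : A) : x = \sum_t std_vec t *+ std_coord t x.
Proof.
apply/ffunP => i; rewrite abp_sum; apply/rowP => j; rewrite summxE.
rewrite (bigD1 (Tagged (fun i => 'I_(tnth rho i)) j)) //= big1 => [|t nt].
  by rewrite addr0 abpMn mulmxnE ffunE mxE eqxx natr_Zp.
by rewrite abpMn mulmxnE ffunE mxE eq_sym (negbTE nt) mul0rn.
Qed.

Definition sorted_index : seq abp_index :=
  sort (fun t u => (index_exp u <= index_exp t)%N) (enum abp_index).
(** The default 0 past the last index stands for lambda_(k+1) = 0. *)
Definition sorted_exp a : nat := nth 0%N (map index_exp sorted_index) a.
Definition sorted_vec a : A := nth 0 (map std_vec sorted_index) a.
Definition sorted_coord a (x : A) : nat :=
  nth 0%N (map (std_coord^~ x) sorted_index) a.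

Lemma sorted_exp_default a : (size sorted_index <= a)%N -> sorted_exp a = 0%N.
Proof. by move=> le; rewrite /sorted_exp nth_default ?size_map. Qed.

Lemma sorted_basis :
  pbasis p (size sorted_index) sorted_exp sorted_vec sorted_coord.
Proof.
split.
- move=> a x y.
  case: (ltnP a (size sorted_index)) => [lt | le]; last first.
    by rewrite sorted_exp_default // !modn1.
  rewrite /sorted_coord /sorted_exp.
  case E : sorted_index lt => [//|t0 s] lt; rewrite -E in lt *.
  by rewrite !(nth_map t0) // std_coordD.
- move=> a b.
  case: (ltnP a (size sorted_index)) => [lt | le]; last first.
    by rewrite sorted_exp_default // !modn1.
  rewrite /sorted_coord /sorted_exp /sorted_vec.
  case E : sorted_index lt => [//|t0 s] lt; rewrite -E in lt *.
  rewrite !(nth_map t0 0%N) //.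
  case: (ltnP b (size sorted_index)) => [ltb | le]; last first.
    rewrite (nth_default 0) ?size_map // (ltn_eqF (leq_trans lt le)).
    by rewrite /std_coord abp0 mxE.
  rewrite (nth_map t0) // std_coord_vec nth_uniq //.
  by rewrite sort_uniq enum_uniq.
- move=> a; rewrite /sorted_vec /sorted_exp.
  case: (ltnP a (size sorted_index)) => [lt | le]; last first.
    by rewrite nth_default ?size_map // mul0rn.
  case E : sorted_index lt => [//|t0 s] lt; rewrite -E in lt *.
  by rewrite !(nth_map t0) // std_vec_order.
move=> x; rewrite {1}(std_vec_gen x).
transitivity (\sum_(t <- sorted_index) std_vec t *+ std_coord t x).
  by rewrite [RHS](perm_big (enum abp_index)) ?big_enum // perm_sort.
rewrite /sorted_vec /sorted_coord; case E : sorted_index => [|t0 s].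
  by rewrite big_nil big_ord0.
rewrite -E (big_nth t0) big_mkord; apply: eq_bigr => a _.
by rewrite !(nth_map t0).
Qed.

Lemma sorted_index_exp_sorted : sorted geq (map index_exp sorted_index).
Proof.
rewrite sorted_map; apply: (@sort_sorted _ (fun t u => (index_exp u <= index_exp t)%N)).
by move=> t u; apply: leq_total.
Qed.

Lemma sorted_exp_anti a b : (a <= b)%N -> (sorted_exp b <= sorted_exp a)%N.
Proof.
move=> le; rewrite /sorted_exp.
case: (ltnP b (size sorted_index)) => [lt | leb]; last first.
  by rewrite nth_default ?size_map.
have srt := sorted_index_exp_sorted.
have geq_trans : transitive geq by move=> x y z /= h1 h2; apply: leq_trans h2 h1.
apply: (sorted_leq_nth geq_trans leqnn 0%N srt) => //; rewrite inE size_map //.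
exact: leq_ltn_trans lt.
Qed.

Lemma sorted_exp_gt0 a : (a < size sorted_index)%N -> (0 < sorted_exp a)%N.
Proof.
move=> lt; rewrite /sorted_exp; case E : sorted_index lt => [//|t0 s] lt.
by rewrite -E (nth_map t0) ?E //; apply: lambda_gt0.
Qed.

Lemma Aut_add_aut : Aut [set: A] = add_aut A.
Proof.
apply/setP => g; rewrite inE; apply/andP/add_autP => [[_ /morphicP gM] x y | gD].
  by apply: (gM x y); rewrite inE.
split; first by apply/subsetP => x; rewrite !inE.
by apply/morphicP => x y _ _; apply: gD.
Qed.

Lemma card_abp_pnat : p.-nat #|{: A}|.
Proof.
suff: p.-group [set: A] by rewrite /pgroup cardsT.
rewrite -pnat_exponent.
apply: (@pnat_dvd _ (p ^ sorted_exp 0)); last by rewrite pnatX pnat_id.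
apply/exponentP => x _.
have -> m : (x ^+ m)%g = x *+ m by elim: m => // m IHm; rewrite expgS IHm mulrS.
apply/eqP/(mulrn_eq0P sorted_basis) => i _.
by apply/dvdn_mulr/dvdn_exp2l/sorted_exp_anti.
Qed.

Hypothesis rho_gt0 : forall i : 'I_k, (0 < tnth rho i)%N.

Lemma mem_index_exp x : (x \in map index_exp sorted_index) = (x \in lambda).
Proof.
apply/mapP/tnthP => [[t _ ->] | [i ->]]; first by exists (tag t).
exists (Tagged (fun i => 'I_(tnth rho i)) (Ordinal (rho_gt0 i))) => //.
by rewrite mem_sort mem_enum.
Qed.

End StandardBasis.

(** The right-hand condition depends only on the set of values. It therefore transfers between the
    distinct parts and the list of exponents with multiplicities. *)
Lemma sorted_gapP (s : seq nat) : sorted geq s ->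
  (forall i, (i < size s)%N -> (nth 0%N s i <= (nth 0%N s i.+1).+1)%N) <->
  (forall x, x \in s -> (1 < x)%N -> x.-1 \in s).
Proof.
move=> srt.
have geq_trans : transitive geq by move=> x y z /= h1 h2; apply: leq_trans h2 h1.
have anti i j : (i <= j)%N -> (nth 0%N s j <= nth 0%N s i)%N.
  move=> le; case: (ltnP j (size s)) => [ltj | lej]; last by rewrite nth_default.
  apply: (sorted_leq_nth geq_trans leqnn 0%N srt) => //; rewrite inE //.
  exact: leq_ltn_trans ltj.
split=> [gap x xs x1 | pred_s i lt]; last first.
  case: (leqP (nth 0%N s i) 1) => [/leq_trans -> // | v1].
  (* A position j holding the predecessor comes after i by monotonicity, so entry i.+1 is at least
     that value. *)
  have /(nthP 0%N)[j ltj sj] := pred_s _ (mem_nth 0%N lt) v1.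
  rewrite -(prednK (ltnW v1)) ltnS -sj; apply: (anti).
  rewrite ltnNge; apply/negP => /anti; rewrite sj leqNgt => /negP[].
  by rewrite prednK // ltnW.
(* The first entry below x follows an entry that is at least x, so the gap condition makes it x - 1.
   This is positive, so m is not past the end. *)
pose m := find (fun y => y < x)%N s.
have sm : (nth 0%N s m < x)%N.
  case: (ltnP m (size s)) => [lt | le]; last by rewrite nth_default // ltnW.
  by apply: (nth_find 0%N (a := fun y => y < x)%N); rewrite has_find.
have m_gt0 : (0 < m)%N.
  rewrite lt0n; apply: contraTneq sm => ->; rewrite -leqNgt.
  by have /(nthP 0%N)[j _ <-] := xs; apply: anti.
have ltm : (m.-1 < m)%N by rewrite prednK.
have lts : (m.-1 < size s)%N by apply: leq_trans ltm (find_size _ _).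
have := before_find 0%N ltm; move/negbT; rewrite -leqNgt => xm.
have := leq_trans xm (gap _ lts); rewrite prednK // => xm1.
have sme : nth 0%N s m = x.-1.
  by apply/eqP; rewrite eqn_leq -ltnS prednK ?(ltnW x1) // sm -ltnS prednK ?(ltnW x1).
rewrite -sme mem_nth //.
by rewrite ltnNge; apply/negP => /(nth_default 0%N) e0; move: x1; rewrite -subn_gt0 subn1 -sme e0.
Qed.

Local Open Scope nat_scope.

Theorem theorem6p40 (p k : nat) (lambda rho : k.-tuple nat)
    (k_gt0 : 0 < k)
    (lambda_decr : sorted gtn lambda)
    (lambda_gt0 : forall i : 'I_k, 0 < tnth lambda i)
    (rho_gt0 : forall i : 'I_k, 0 < tnth rho i)
    (p_prime : prime p) (p_odd : odd p) (p_neq3 : p <> 3) :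
  cohomology (trivial_gmodule (aut_abelian_pgroup p lambda rho)
                              (abelian_pgroup p lambda rho)) 2 = 1%G
  <-> (* indices start at 0 and [nth] returns 0 past the end *)
  forall i : nat, i < k -> nth 0 lambda i - nth 0 lambda i.+1 <= 1.
Proof.
apply: iff_trans (cohomology2_eq1P _ _) _.
pose s := sorted_index lambda rho; pose l := sorted_exp lambda rho.
have mem_l := mem_index_exp lambda rho_gt0.
have srt_lambda : sorted geq lambda by apply: sub_sorted lambda_decr => x y /ltnW.
have lambdaP : (forall i, i < k -> nth 0 lambda i - nth 0 lambda i.+1 <= 1) <->
    (forall a, a < size s -> l a <= (l a.+1).+1).
  have e1 := sorted_gapP srt_lambda.
  have e2 := sorted_gapP (sorted_index_exp_sorted lambda rho).
  rewrite size_tuple in e1; rewrite size_map in e2.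
  have e3 : (forall x, x \in (lambda : seq nat) -> 1 < x -> x.-1 \in (lambda : seq nat)) <->
      (forall x, x \in map (@index_exp _ lambda _) s -> 1 < x ->
        x.-1 \in map (@index_exp _ lambda _) s).
    by split=> h x; [rewrite !mem_l; apply: h | have := h x; rewrite !mem_l].
  apply: iff_trans _ (iff_trans e1 (iff_trans e3 (iff_sym e2))).
  by split=> h i /h; rewrite leq_subLR addn1.
apply: iff_trans _ (iff_sym lambdaP).
have Be := sorted_basis rho p_prime lambda_gt0.
have imG : sgval @* [set: aut_abelian_pgroup p lambda rho] =
    add_aut (abelian_pgroup p lambda rho).
  by rewrite -Aut_add_aut; apply: im_sgval.
split=> [split a lt | gap f].
  rewrite leqNgt; apply/negP => gap_a.
  (* Up to index a the exponents are at least l a; after it they are at most l a - 2. *)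
  apply: (gap_not_coboundary2 (m := a.+1) (v := l a) p_prime Be _ lt _ _ _ imG split) => //.
  - by apply: leq_ltn_trans gap_a.
  - by move=> b; rewrite ltnS; apply: sorted_exp_anti.
  - move=> b le; rewrite addn2; apply: leq_trans gap_a.
    by rewrite !ltnS; apply: sorted_exp_anti.
have pA := card_abp_pnat rho p_prime lambda_gt0.
apply: (superperfect_coboundary2 pA _ (injm_sgval _) imG).
apply: (add_aut_superperfect p_prime Be) => //.
- exact: sorted_exp_anti.
- exact: sorted_exp_gt0.
- exact: sorted_exp_default.
Qed.
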